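(* Let $k\in\mathbb{N}$, let $\mathcal{D}:\mathbb{R}_{>0}\times\mathbb{N}\to\mathbb{R}_{>0}$ be an arbitrary function, and let $\eta>0$. Let $Z$ be a finite abelian group and let $f:Z\to\mathbb{C}$ be a 1-bounded function. Let $f=\sum_{\chi\in S}g_\chi+g_e+f_e+f_r$, with complexity bound $m\le N(\eta,\mathcal{D})$, be an $(\eta,\mathcal{D})$-regularity decomposition of $f$ of order $k$ (as defined in the context). Then $$\Big|\,\|f\|_2^2-\sum_{\chi\in S}\|g_\chi\|_2^2-\|f_r\|_2^2\,\Big|\le(|S|^2+4)\,\mathcal{D}(\eta,m)+8\eta.$$
   Context: Finite groups. $Z$ is a finite abelian group; $\langle f,g\rangle=\mathbb{E}_{x\in Z}f(x)\overline{g(x)}$, $\|f\|_p=(\mathbb{E}_x|f(x)|^p)^{1/p}$; 1-bounded means $|f|\le1$. $\|f\|_{U^k}=\big(\mathbb{E}_{x,t_1,\dots,t_k}\prod_{v\in\{0,1\}^k}\mathcal{C}^{|v|}f(x+v_1t_1+\cdots+v_kt_k)\big)^{1/2^k}$, with $\mathcal{C}$ complex conjugation and $|v|=\sum v_i$. For $f,g:Z\to\mathbb{C}$, $\langle f,g\rangle_{U^k}=\mathbb{E}_{x,t_1,\dots,t_k}\prod_{v\in\{0,1\}^k}\mathcal{C}^{|v|}f_v(x+v_1t_1+\cdots+v_kt_k)$ with $f_v=f$ if $v_k=0$ and $f_v=g$ if $v_k=1$. Regularity decomposition. An $(\eta,\mathcal{D})$-regularity decomposition of order $k$ of a 1-bounded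 $f$, with complexity bound $m$, consists of a $k$-step cfr nilspace $Y$ of complexity at most $m$, a $\mathcal{D}(\eta,m)$-balanced morphism $\phi:Z\to Y$, a 1-bounded $m$-Lipschitz $F:Y\to\mathbb{C}$, and $f=f_s+f_e+f_r$ with $f_s=F\circ\phi$, $\|f_e\|_1\le\eta$, $\|f_r\|_\infty\le1$, $\max(\|f_r\|_{U^{k+1}},|\langle f_r,f_s\rangle|,|\langle f_r,f_e\rangle|)\le\mathcal{D}(\eta,m)$, together with $S\subset\widehat{Z_k(Y)}$, $|S|\le Q(\eta,m)$, such that with $g_\chi=F_\chi\circ\phi$ we have $f_s=\sum_{\chi\in S}g_\chi+g_e$, $\|g_e\|_\infty\le\eta$, and $\max(|\langle g_\chi,g_{\chi'}\rangle|,\langle g_\chi,g_{\chi'}\rangle_{U^{k+1}})\le\mathcal{D}(\eta,m)$ for $\chi\ne\chi'$ in $S$. The paper's regularity theorem says that for every $\eta,\mathcal{D}$ there is $N(\eta,\mathcal{D})$ such that every 1-bounded $f$ on every finite abelian group has such a decomposition for some $m\in[1,N(\eta,\mathcal{D})]$. Nilspaces. A cube morphism $\{0,1\}^m\to\{0,1\}^n$ is the restriction of an affine homomorphism $\mathbb{Z}^m\to\mathbb{Z}^n$. A nilspace is a set $X$ with sets $C^n(X)\subset X^{\{0,1\}^n}$, $n\ge0$ ($n$-cubes), such that: $c\circ\psi\in C^m(X)$ for every $c\in C^n(X)$ and cube morphism $\psi:\{0,1\}^m\to\{0,1\}^n$; $C^1(X)=X^{\{0,1\}}$; and any $c':\{0,1\}^n\setminus\{1^n\}\to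 X$ whose restriction to each face $\{v:v_i=0\}$ is an $(n-1)$-cube extends to an $n$-cube. It is $k$-step if this extension is unique for $n=k+1$. A morphism is a map sending cubes to cubes by composition. For an abelian group $A$, $\mathcal{D}_j(A)$ is the nilspace on $A$ whose $n$-cubes are the maps $c:\{0,1\}^n\to A$ with $\sum_{v\in\{0,1\}^{j+1}}(-1)^{|v|}c(\psi(v))=0$ for all cube morphisms $\psi:\{0,1\}^{j+1}\to\{0,1\}^n$. A finite abelian group $Z$ is viewed as $\mathcal{D}_1(Z)$, whose $n$-cubes are the maps $v\mapsto x+v_1t_1+\cdots+v_nt_n$. A compact nilspace is a nilspace with a compact Hausdorff second-countable topology with every $C^n(X)$ closed. Structure groups. For a $k$-step compact nilspace $X$ let $x\sim_jy$ iff there are $c,c'\in C^{j+1}(X)$ with $c(0)=x$, $c'(0)=y$ and $c=c'$ elsewhere; $X_j=X/\sim_j$ ($X_k=X$, $X_0$ a point). There are compact abelian groups $Z_j(X)$ (structure groups), $1\le j\le k$, with $Z_j(X)$ acting freely and continuously on $X_j$, orbits being the fibres of $X_j\to X_{j-1}$, and such that for $c\in C^n(X_j)$ the cubes in $C^n(X_j)$ with the same image in $X_{j-1}$ as $c$ are exactly $c+d$, $d\in C^n(\mathcal{D}_j(Z_j(X)))$. The action of $z\in Z_k(X)$ on $x\in X$ is $x+z$. $X$ is a cfr (compact finite-rank) nilspace if all $Z_j(X)$ are Lie groups. The Haar measure $\mu_{C^n(X)}$ is the unique Borel probability measure on $C^n(X)$ defined recursively by being invariant under addition of elements of $C^n(\mathcal{D}_k(Z_k(X)))$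 and projecting to $\mu_{C^n(X_{k-1})}$; for $Z$ finite, $\mu_{C^n(Z)}$ is uniform. For bounded Borel $F:X\to\mathbb{C}$ and $\chi\in\widehat{Z_k(X)}$, $F_\chi(x)=\int_{Z_k(X)}F(x+z)\overline{\chi(z)}\,d\mu(z)$ ($\mu$ probability Haar measure). Fixed choices. An enumeration $Y_1,Y_2,\dots$ of the isomorphism classes of cfr nilspaces is fixed; $Y_i$ has complexity $i$. A $k$-step cfr nilspace is isomorphic to a quotient $F/H$ of a free nilspace $F=\prod_{i=1}^k\mathcal{D}_i(\mathbb{Z}^{a_i}\times\mathbb{R}^{b_i})$ by a $k$-th order lattice action $H$, and is a smooth compact manifold with the structure making $F\to F/H$ a submersion; each $Y_i$ carries a fixed Riemannian metric tensor invariant under its last structure group, with $d(x,y)$ the geodesic distance within connected components and 1 across components; Lipschitz constants are with respect to $d$. For each $Y_i$ and $n$ a metric $d_n$ generating the weak topology on Borel probability measures on $C^n(Y_i)$ is fixed; $\phi:Z\to Y_i$ is $b$-balanced if $d_n\big(\mu_{C^n(Z)}\circ(\phi^{\{0,1\}^n})^{-1},\mu_{C^n(Y_i)}\big)\le b$ for every $n\le1/b$. For each $Y_i$, with last structure group $Z_k$, fix $Q_{Y_i}:\mathbb{R}_{>0}\times\mathbb{R}_{\ge0}\to\mathbb{N}$ such that for all $C,\delta>0$ there is $S\subset\widehat{Z_k}$ with $|S|\le Q_{Y_i}(\delta,C)$ and $\|F-\sum_{\chi\in S}F_\chi\|_\infty\le\delta$ for every $C$-Lipschitz $F:Y_i\to\mathbb{C}$.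 Put $Q(\eta,m)=\max_{i\le m}Q_{Y_i}(\eta,m)$. *)

(* Defs.v *)
From HB Require Import structures.
From mathcomp Require Import all_boot all_order all_algebra.
From mathcomp Require Import finmap complex.
From mathcomp Require Import all_classical all_reals all_analysis.

Set Implicit Arguments.
Unset Strict Implicit.
Unset Printing Implicit Defensive.

Import Order.TTheory GRing.Theory Num.Theory.
Import numFieldNormedType.Exports.

Local Open Scope classical_set_scope.
Local Open Scope ring_scope.

Definition cabs (R : realType) (z : R[i]) : R := ComplexField.Normc.normc z.

(* A bound [b] on the uniform norm; also used on nilspaces, where the
   supremum is a genuine supremum and not an essential one. *)
Definition norm_inf_le (R : realType) (T : Type) (f : T -> R[i]) (b : R) : Prop :=
  forall x, cabs (f x) <= b.

Definition avg (K : numFieldType) (T : finType) (F : T -> K) : K :=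
  (\sum_x F x) / #|T|%:R.

Definition inner (R : realType) (Z : finZmodType) (f g : Z -> R[i]) : R[i] :=
  avg (fun x => f x * conjc (g x)).

Definition lpnorm (R : realType) (Z : finZmodType) (p : R) (f : Z -> R[i]) : R :=
  avg (fun x => cabs (f x) `^ p) `^ p^-1.

Definition vertex (n : nat) : finType := {ffun 'I_n -> bool}.

Definition weight (n : nat) (v : vertex n) : nat := (\sum_i v i)%N.

Definition gowers_form (R : realType) (Z : finZmodType) (k : nat)
    (F : vertex k -> Z -> R[i]) : R[i] :=
  avg (fun p : Z * {ffun 'I_k -> Z} =>
    \prod_(v : vertex k)
      iter (weight v) (@conjc R) (F v (p.1 + \sum_i p.2 i *+ v i))).

(* The Gowers form of a single function is a nonnegative real number when
   [0 < k]; [complex.Re] reads it in [R]. *)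
Definition gowers_norm (R : realType) (Z : finZmodType) (k : nat)
    (f : Z -> R[i]) : R :=
  complex.Re (gowers_form (fun _ : vertex k => f)) `^ ((2 ^ k)%:R)^-1.

(* [gowers_inner k f g] is the pairing of [f] and [g] attached to U^(k+1). *)
Definition gowers_inner (R : realType) (Z : finZmodType) (k : nat)
    (f g : Z -> R[i]) : R[i] :=
  gowers_form (fun v : vertex k.+1 => if v ord_max then g else f).

Definition vertex0 (n : nat) : vertex n := [ffun=> false].
Definition vertex1 (n : nat) : vertex n := [ffun=> true].

Definition cube_morphism (m n : nat) (psi : vertex m -> vertex n) : Prop :=
  exists (a : 'M[int]_(m, n)) (b : 'rV[int]_n), forall v j,
    ((psi v j : nat)%:R : int) = (\sum_i ((v i : nat)%:R * a i j)) + b 0 j.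

(* The identification of {0,1}^n with the face [v_i = 0] of {0,1}^(n+1). *)
Definition lower_face (n : nat) (i : 'I_n.+1) (w : vertex n) : vertex n.+1 :=
  [ffun j => if unlift i j is Some j' then w j' else false].

Definition cube_structure (T : Type) := forall n, set (vertex n -> T).

(* A function on {0,1}^n minus 1^n is represented by a total function whose
   value at 1^n is ignored.  The corner axiom for n = 0 says that the
   nilspace is nonempty. *)
Record is_nilspace (T : Type) (C : cube_structure T) : Prop := IsNilspace {
  nil_nonempty : exists x : T, True;
  nil_comp : forall m n (c : vertex n -> T) (psi : vertex m -> vertex n),
    C n c -> cube_morphism psi -> C m (c \o psi);
  nil_ergodic : forall c : vertex 1 -> T, C 1%N c;
  nil_corner : forall n (c' : vertex n.+1 -> T),
    (forall i, C n (c' \o lower_face i)) ->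
    exists2 c, C n.+1 c & forall v, v != vertex1 n.+1 -> c v = c' v }.

(* [k]-step: the completion of (k+1)-corners is unique. *)
Definition is_step (T : Type) (C : cube_structure T) (k : nat) : Prop :=
  forall c c', C k.+1 c -> C k.+1 c' ->
    (forall v, v != vertex1 k.+1 -> c v = c' v) -> c = c'.

Definition nil_morphism (S T : Type) (CS : cube_structure S)
    (CT : cube_structure T) (phi : S -> T) : Prop :=
  forall n c, CS n c -> CT n (phi \o c).

Definition Dcubes (j : nat) (A : zmodType) : cube_structure A :=
  fun n => [set c | forall psi : vertex j.+1 -> vertex n, cube_morphism psi ->
    \sum_v c (psi v) *~ (-1) ^+ weight v = 0].

Definition sim (T : Type) (C : cube_structure T) (j : nat) (x y : T) : Prop :=
  exists c c', [/\ C j.+1 c, C j.+1 c', c (vertex0 _) = x, c' (vertex0 _) = y &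
    forall v, v != vertex0 _ -> c v = c' v].

(* Translations of height i (elements of the group Theta_i): applying [a] on
   any face of codimension i of a cube gives a cube.  The face consists of
   the [v] that agree with [w] on the coordinates in [I]. *)
Definition is_translation (T : Type) (C : cube_structure T) (i : nat)
    (a : T -> T) : Prop :=
  forall n (I : {set 'I_n}) (w : vertex n) c, #|I| = i -> C n c ->
    C n (fun v => if [forall j in I, v j == w j] then a (c v) else c v).

Definition cube_space (n : nat) (T : Type) := prod_topology (fun _ : vertex n => T).
HB.instance Definition _ (n : nat) (T : topologicalType) :=
  Topological.copy (cube_space n T) (prod_topology (fun _ : vertex n => T)).
HB.instance Definition _ (n : nat) (T : ptopologicalType) :=
  isPointed.Build (cube_space n T) (fun=> point).

(* The point of a [ptopologicalType] only records nonemptiness; nothing is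
   required to preserve it. *)
Record compactNilspace := CompactNilspace {
  nil_space :> ptopologicalType;
  nil_cubes : cube_structure nil_space;
  nil_nilspace : is_nilspace nil_cubes;
  nil_compact : compact [set: nil_space];
  nil_hausdorff : hausdorff_space nil_space;
  nil_countable : @second_countable nil_space;
  nil_closed : forall n,
    closed (nil_cubes (n := n) : set (cube_space n nil_space)) }.

Arguments nil_cubes : clear implicits.

Definition nil_iso (X Y : compactNilspace) : Prop :=
  exists (f : X -> Y) (g : Y -> X),
    [/\ cancel f g, cancel g f, continuous f, continuous g &
      forall n c, nil_cubes X n c <-> nil_cubes Y n (f \o c)].

(* X_j = X / ~_j, as the set of classes, with the quotient topology. *)
Definition nil_factor (X : compactNilspace) (j : nat) : Type :=
  {A : set X | exists x, A = [set y | sim (nil_cubes X) j x y]}.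

Definition factor_map (X : compactNilspace) (j : nat) (x : X) : nil_factor X j :=
  exist _ [set y | sim (nil_cubes X) j x y] (ex_intro _ x erefl).

Section FactorTopology.
Variables (X : compactNilspace) (j : nat).

Definition factor_open (U : set (nil_factor X j)) : Prop :=
  open (@factor_map X j @^-1` U).

Lemma factor_openT : factor_open setT.
Proof. by rewrite /factor_open preimage_setT; exact: openT. Qed.

Lemma factor_openI : setI_closed factor_open.
Proof. by move=> A B oA oB; rewrite /factor_open preimage_setI; exact: openI. Qed.

Lemma factor_open_bigU (I : Type) (F : I -> set (nil_factor X j)) :
  (forall i, factor_open (F i)) -> factor_open (\bigcup_i F i).
Proof.
by move=> oF; rewrite /factor_open preimage_bigcup; apply: bigcup_open => i _; exact: oF.
Qed.

HB.instance Definition _ := gen_eqMixin (nil_factor X j).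
HB.instance Definition _ := gen_choiceMixin (nil_factor X j).
HB.instance Definition _ := isPointed.Build (nil_factor X j) (factor_map j point).
HB.instance Definition _ := isOpenTopological.Build (nil_factor X j)
  factor_openT factor_openI factor_open_bigU.

End FactorTopology.

Definition factor_cubes (X : compactNilspace) (j : nat) :
    cube_structure (nil_factor X j) :=
  fun n => [set c | exists2 c0, nil_cubes X n c0 & c = @factor_map X j \o c0].

(* The projection X_j -> X_i, for i <= j, computed on a representative. *)
Definition factor_proj (X : compactNilspace) (j i : nat) (u : nil_factor X j) :
    nil_factor X i :=
  factor_map i (projT1 (cid (projT2 u))).

Notation borel T := (g_sigma_algebraType (@open T)).

Definition borel_set (T : topologicalType) (A : set T) : Prop := <<s @open T >> A.

Definition pgroup (G : topologicalZmodType) : Type := G.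
HB.instance Definition _ (G : topologicalZmodType) :=
  TopologicalZmodule.on (pgroup G).
HB.instance Definition _ (G : topologicalZmodType) :=
  isPointed.Build (pgroup G) (0 : G).

Definition is_haar (R : realType) (G : topologicalZmodType)
    (mu : probability (borel (pgroup G)) R) : Prop :=
  forall (a : G) (A : set G), borel_set A -> mu [set x | A (x + a)] = mu A.

Definition cintegral (R : realType) d (T : measurableType d)
    (mu : {measure set T -> \bar R}) (f : T -> R[i]) : R[i] :=
  Complex (\int[mu]_x complex.Re (f x)) (\int[mu]_x complex.Im (f x)).

Definition is_character (R : realType) (G : topologicalZmodType)
    (chi : G -> R[i]) : Prop :=
  [/\ forall a b, chi (a + b) = chi a * chi b,
      forall a, cabs (chi a) = 1,
      continuous (fun a => complex.Re (chi a) : R^o) &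
      continuous (fun a => complex.Im (chi a) : R^o)].

Fixpoint Cn_on (R : realType) (V W : normedModType R) (m : nat) (U : set V)
    (f : V -> W) : Prop :=
  (forall x, U x -> {for x, continuous f}) /\
  if m is m'.+1 then
    (forall x, U x -> differentiable f x) /\
    (forall v, Cn_on m' U (fun x => 'D_v f x))
  else True.

Definition smooth_on (R : realType) (V W : normedModType R) (U : set V)
    (f : V -> W) : Prop :=
  open U /\ forall m, Cn_on m U f.

Record chart (R : realType) (M : topologicalType) (n : nat) := Chart {
  chart_dom : set M;
  chart_cod : set 'rV[R]_n;
  coord : M -> 'rV[R]_n;
  param : 'rV[R]_n -> M }.

Record is_chart (R : realType) (M : topologicalType) (n : nat)
    (c : chart R M n) : Prop := IsChart {
  chart_dom_open : open (chart_dom c);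
  chart_cod_open : open (chart_cod c);
  coord_in : forall x, chart_dom c x -> chart_cod c (coord c x);
  param_in : forall u, chart_cod c u -> chart_dom c (param c u);
  coordK : forall x, chart_dom c x -> param c (coord c x) = x;
  paramK : forall u, chart_cod c u -> coord c (param c u) = u;
  coord_cont : forall x, chart_dom c x -> {for x, continuous (coord c)};
  param_cont : forall u, chart_cod c u -> {for u, continuous (param c)} }.

Definition transition (R : realType) (M : topologicalType) (n : nat)
    (c1 c2 : chart R M n) : 'rV[R]_n -> 'rV[R]_n :=
  coord c2 \o param c1.

Record is_atlas (R : realType) (M : topologicalType) (n : nat)
    (A : set (chart R M n)) : Prop := IsAtlas {
  atlas_chart : forall c, A c -> is_chart c;
  atlas_cover : forall x, exists2 c, A c & chart_dom c x;
  atlas_smooth : forall c1 c2, A c1 -> A c2 ->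
    smooth_on (chart_cod c1 `&` param c1 @^-1` chart_dom c2)
              (transition c1 c2) }.

Definition is_lie_group (R : realType) (G : topologicalZmodType) : Prop :=
  exists (n : nat) (A : set (chart R G n)),
  [/\ is_atlas A,
      forall c1 c2 c3, A c1 -> A c2 -> A c3 ->
        smooth_on
          [set u : 'rV[R]_n * 'rV[R]_n | [/\ chart_cod c1 u.1, chart_cod c2 u.2 &
            chart_dom c3 (param c1 u.1 + param c2 u.2)]]
          (fun u => coord c3 (param c1 u.1 + param c2 u.2)) &
      forall c1 c2, A c1 -> A c2 ->
        smooth_on
          (chart_cod c1 `&` [set u | chart_dom c2 (- param c1 u)])
          (fun u => coord c2 (- param c1 u))].

(* Groups Z_j for all j >= 1; the entry at 0 is unconstrained.  On a k-step
   nilspace the fields force Z_j to be trivial for j > k. *)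
Record structureGroups (R : realType) (X : compactNilspace) :=
    StructureGroups {
  sgroup : nat -> topologicalZmodType;
  sact : forall j, nil_factor X j -> sgroup j -> nil_factor X j;
  shaar : forall j, probability (borel (pgroup (sgroup j))) R;
  sg_compact : forall j, (0 < j)%N -> compact [set: sgroup j];
  sg_hausdorff : forall j, (0 < j)%N -> hausdorff_space (sgroup j);
  sg_haar : forall j, (0 < j)%N -> is_haar (shaar j);
  sact0 : forall j, (0 < j)%N -> forall u : nil_factor X j, sact u 0 = u;
  sactD : forall j, (0 < j)%N -> forall (u : nil_factor X j) a b,
    sact u (a + b) = sact (sact u a) b;
  sact_free : forall j, (0 < j)%N -> forall (u : nil_factor X j) a,
    sact u a = u -> a = 0;
  sact_cont : forall j, (0 < j)%N ->
    continuous (fun p : nil_factor X j * sgroup j => sact p.1 p.2);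
  sact_orbit : forall j, (0 < j)%N -> forall u u' : nil_factor X j,
    (factor_proj j.-1 u = factor_proj j.-1 u' <-> exists a, u' = sact u a);
  sact_cubes : forall j, (0 < j)%N -> forall n c c',
    factor_cubes (n := n) c ->
    (factor_cubes c' /\
       @factor_proj X j j.-1 \o c' = @factor_proj X j j.-1 \o c) <->
    (exists2 d, Dcubes j (n := n) d & c' = fun v => sact (c v) (d v)) }.

Record cfrNilspace (R : realType) := CfrNilspace {
  cfr_space :> compactNilspace;
  cfr_groups : structureGroups R cfr_space;
  cfr_step : exists k, is_step (nil_cubes cfr_space) k;
  cfr_lie : forall j, (0 < j)%N -> is_lie_group R (sgroup cfr_groups j) }.

Notation Zgrp Y k := (sgroup (cfr_groups Y) k).

(* x + z for z in Z_k(Y), on a k-step nilspace Y; there Y -> Y_k is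
   bijective, and the action of Z_k(Y) on Y_k is transported to Y. *)
Definition shift_last (R : realType) (Y : cfrNilspace R) (k : nat) (x : Y)
    (z : Zgrp Y k) : Y :=
  get [set y | factor_map k y = sact (factor_map k x) z].

(* F_chi, the component of [F] along the character [chi]. *)
Definition fourier_part (R : realType) (Y : cfrNilspace R) (k : nat)
    (F : Y -> R[i]) (chi : Zgrp Y k -> R[i]) (x : Y) : R[i] :=
  cintegral (shaar (cfr_groups Y) k)
    (fun z => F (shift_last x z) * conjc (chi z)).

(* The Haar measure on C^n(Y), as a Borel measure on Y^({0,1}^n) carried by
   C^n(Y).  The recursion over the factors is unfolded: the image of [mu] on
   the n-cubes of each Y_j is invariant under n-cubes of D_j(Z_j(Y)). *)
Definition is_cube_haar (R : realType) (Y : cfrNilspace R) (n : nat)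
    (mu : probability (borel (cube_space n Y)) R) : Prop :=
  mu (nil_cubes Y n) = 1%E /\
  forall j, (0 < j)%N -> forall d : vertex n -> Zgrp Y j, Dcubes j d ->
  forall A : set (cube_space n (nil_factor Y j)), borel_set A ->
    mu [set c | A (fun v => sact (factor_map j (c v)) (d v))] =
    mu [set c | A (fun v => factor_map j (c v))].

(* The product of the D_i(Z^(a_i) x R^(b_i)), with the coordinates of all
   degrees gathered: [fdegZ] and [fdegR] give the degree of each integer and
   of each real coordinate. *)
Record freeNilspace := FreeNilspace {
  fstep : nat;
  fdimZ : nat;
  fdimR : nat;
  fdegZ : 'I_fdimZ -> nat;
  fdegR : 'I_fdimR -> nat;
  fdegZ_bound : forall a, (0 < fdegZ a <= fstep)%N;
  fdegR_bound : forall b, (0 < fdegR b <= fstep)%N }.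

Definition free_carrier (R : realType) (P : freeNilspace) : zmodType :=
  ('rV[int]_(fdimZ P) * 'rV[R]_(fdimR P))%type.

Definition free_cubes (R : realType) (P : freeNilspace) :
    cube_structure (free_carrier R P) :=
  fun n => [set c : vertex n -> free_carrier R P |
    (forall a, Dcubes (fdegZ a) (fun v => (c v).1 0 a)) /\
    (forall b, Dcubes (fdegR b) (fun v => (c v).2 0 b))].

(* [z] lies in the i-th structure group of the free nilspace. *)
Definition in_degree (R : realType) (P : freeNilspace) (i : nat)
    (z : free_carrier R P) : Prop :=
  (forall a, fdegZ a != i -> z.1 0 a = 0) /\
  (forall b, fdegR b != i -> z.2 0 b = 0).

(* Continuity for the product of discrete and Euclidean topologies. *)
Definition free_continuous (R : realType) (P : freeNilspace)
    (a : free_carrier R P -> free_carrier R P) : Prop :=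
  forall p : 'rV[int]_(fdimZ P),
    continuous (fun r : 'rV[R]_(fdimR P) => (a (p, r)).2) /\
    forall r, \forall r' \near r, (a (p, r')).1 = (a (p, r)).1.

(* The subgroup of the i-th structure group through which the elements of
   [H] of height i act on the i-th factor. *)
Definition lattice_part (R : realType) (P : freeNilspace)
    (H : set (free_carrier R P -> free_carrier R P)) (i : nat) :
    set (free_carrier R P) :=
  [set z | in_degree i z /\ exists h,
    [/\ H h, is_translation (@free_cubes R P) i h &
        forall x, sim (@free_cubes R P) i (h x) (x + z)]].

(* A lattice action whose order is the step of the free nilspace: a group of
   continuous translations that is fibre-transitive, and fibrewise discrete
   and cocompact. *)
Record lattice_action (R : realType) (P : freeNilspace)
    (H : set (free_carrier R P -> free_carrier R P)) : Prop := LatticeAction {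
  la_id : H id;
  la_comp : forall h h', H h -> H h' -> H (h \o h');
  la_inv : forall h, H h -> exists2 h', H h' & cancel h h' /\ cancel h' h;
  la_cont : forall h, H h -> free_continuous h;
  la_trans : forall h, H h -> is_translation (@free_cubes R P) 1 h;
  la_fibre : forall h x i, H h -> sim (@free_cubes R P) i x (h x) ->
    exists h', [/\ H h', is_translation (@free_cubes R P) i.+1 h' & h' x = h x];
  la_discrete : forall i, (0 < i <= fstep P)%N -> exists2 e : R, 0 < e &
    forall z, lattice_part H i z -> z.1 = 0 -> `|z.2| < e -> z.2 = 0;
  la_cocompact : forall i, (0 < i <= fstep P)%N -> exists M : R,
    forall z, in_degree i z -> exists2 y, lattice_part H i y &
      (forall a, `|(z - y).1 0 a|%:~R <= M) /\ `|(z - y).2| <= M }.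

(* [q] exhibits the nilspace Y as F/H: it is onto, its fibres are the orbits
   of H, and Y has the quotient cubes and the quotient topology. *)
Record is_quotient_map (R : realType) (Y : compactNilspace) (P : freeNilspace)
    (H : set (free_carrier R P -> free_carrier R P))
    (q : free_carrier R P -> Y) : Prop := IsQuotientMap {
  qm_onto : forall y, exists x, q x = y;
  qm_orbit : forall x x', q x = q x' <-> exists2 h, H h & x' = h x;
  qm_cubes : forall n c, nil_cubes Y n c <->
    exists2 c0, @free_cubes R P n c0 & c = q \o c0;
  qm_open : forall U : set Y, open U <->
    forall p, open [set r : 'rV[R]_(fdimR P) | U (q (p, r))] }.

(* The smooth structure making F -> F/H a submersion.  Differentials act on
   row vectors on the right, so surjective means [row_full]. *)
Record smoothStructure (R : realType) (Y : cfrNilspace R) := SmoothStructure {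
  ss_free : freeNilspace;
  ss_action : set (free_carrier R ss_free -> free_carrier R ss_free);
  ss_quot : free_carrier R ss_free -> Y;
  ss_step : is_step (nil_cubes Y) (fstep ss_free);
  ss_lattice : lattice_action ss_action;
  ss_quotP : is_quotient_map ss_action ss_quot;
  ss_dim : nat;
  ss_atlas : set (chart R Y ss_dim);
  ss_atlasP : is_atlas ss_atlas;
  ss_submersion : forall p c, ss_atlas c ->
    let U := [set r | chart_dom c (ss_quot (p, r))] in
    let f := fun r => coord c (ss_quot (p, r)) in
    smooth_on U f /\ forall r, U r -> row_full (jacobian f r) }.

(* [tensor c x] is the Gram matrix at [x] in the chart [c]. *)
Record riemannianMetric (R : realType) (Y : cfrNilspace R)
    (S : smoothStructure Y) := RiemannianMetric {
  tensor : chart R Y (ss_dim S) -> Y -> 'M[R]_(ss_dim S);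
  tensor_sym : forall c x, ss_atlas c -> chart_dom c x ->
    (tensor c x)^T = tensor c x;
  tensor_pos : forall c x, ss_atlas c -> chart_dom c x ->
    forall v : 'rV[R]_(ss_dim S), v != 0 -> 0 < (v *m tensor c x *m v^T) 0 0;
  tensor_smooth : forall c, ss_atlas c -> forall i j,
    smooth_on (chart_cod c) (fun u => tensor c (param c u) i j : R^o);
  tensor_transition : forall c1 c2 x, ss_atlas c1 -> ss_atlas c2 ->
    chart_dom c1 x -> chart_dom c2 x ->
    let J := jacobian (transition c1 c2) (coord c1 x) in
    tensor c1 x = J *m tensor c2 x *m J^T;
  tensor_invariant : forall k, (0 < k)%N -> is_step (nil_cubes Y) k ->
    forall (z : Zgrp Y k) c1 c2 x, ss_atlas c1 -> ss_atlas c2 ->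
    chart_dom c1 x -> chart_dom c2 (shift_last x z) ->
    let J := jacobian (fun u => coord c2 (shift_last (param c1 u) z))
                      (coord c1 x) in
    tensor c1 x = J *m tensor c2 (shift_last x z) *m J^T }.

Definition segment_length (R : realType) (Y : cfrNilspace R)
    (S : smoothStructure Y) (g : riemannianMetric S) (c : chart R Y (ss_dim S))
    (gam : R -> 'rV[R]_(ss_dim S)) : R :=
  \int[@lebesgue_measure R]_(t in `[0, 1])
    Num.sqrt (('D_1 (gam : R^o -> _) t *m tensor g c (param c (gam t))
               *m ('D_1 (gam : R^o -> _) t)^T) 0 0).

(* [path_length g x y l]: [l] is the length of a piecewise smooth path from
   [x] to [y], cut into finitely many smooth pieces lying each in a chart. *)
Inductive path_length (R : realType) (Y : cfrNilspace R)
    (S : smoothStructure Y) (g : riemannianMetric S) : Y -> Y -> R -> Prop :=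
| PathNil x : path_length g x x 0
| PathCons c (gam : R -> 'rV[R]_(ss_dim S)) y l :
    ss_atlas c -> smooth_on setT (gam : R^o -> _) ->
    (forall t, 0 <= t <= 1 -> chart_cod c (gam t)) ->
    path_length g (param c (gam 1)) y l ->
    path_length g (param c (gam 0)) y (segment_length g c gam + l).

Definition geodesic_dist (R : realType) (Y : cfrNilspace R)
    (S : smoothStructure Y) (g : riemannianMetric S) (x y : Y) : R :=
  if `[< connected_component [set: Y] x y >]
  then inf [set l | path_length g x y l] else 1.

Definition lipschitz_for (R : realType) (Y : cfrNilspace R)
    (S : smoothStructure Y) (g : riemannianMetric S) (L : R) (F : Y -> R[i]) :
    Prop :=
  forall x y, cabs (F x - F y) <= L * geodesic_dist g x y.

Notation cube_prob R n Y := (probability (borel (cube_space n Y)) R).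

(* Borel probability measures on C^n(Y) are the Borel probability measures on
   Y^({0,1}^n) carried by the closed set C^n(Y). *)
Definition on_cubes (R : realType) (Y : cfrNilspace R) (n : nat)
    (P : cube_prob R n Y) : Prop := P (nil_cubes Y n) = 1%E.

Definition cube_test (R : realType) (Y : cfrNilspace R) (n : nat)
    (f : cube_space n Y -> R) : Prop :=
  {within (nil_cubes Y n : set (cube_space n Y)),
     continuous (f : cube_space n Y -> R^o)}.

(* A metric on these measures (with equality tested on Borel sets), whose
   topology is the initial one for the integrals of continuous functions. *)
Record is_weak_metric (R : realType) (Y : cfrNilspace R) (n : nat)
    (d : cube_prob R n Y -> cube_prob R n Y -> R) : Prop := IsWeakMetric {
  wm_eq : forall P Q, on_cubes P -> on_cubes Q ->
    (d P Q = 0 <-> forall A, measurable A -> P A = Q A);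
  wm_sym : forall P Q, on_cubes P -> on_cubes Q -> d P Q = d Q P;
  wm_triangle : forall P Q T, on_cubes P -> on_cubes Q -> on_cubes T ->
    d P T <= d P Q + d Q T;
  wm_finer : forall P f (e : R), on_cubes P -> cube_test f -> 0 < e ->
    exists2 r : R, 0 < r & forall Q, on_cubes Q -> d P Q < r ->
      `|\int[Q]_(c in nil_cubes Y n) f c
        - \int[P]_(c in nil_cubes Y n) f c| < e;
  wm_coarser : forall P (r : R), on_cubes P -> 0 < r ->
    exists (N : nat) (fs : 'I_N -> cube_space n Y -> R) (e : R),
      [/\ 0 < e, forall i, cube_test (fs i) & forall Q, on_cubes Q ->
        (forall i, `|\int[Q]_(c in nil_cubes Y n) fs i c
                     - \int[P]_(c in nil_cubes Y n) fs i c| < e) ->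
        d P Q < r] }.

Definition group_cubes (Z : finZmodType) (n : nat) : {set {ffun vertex n -> Z}} :=
  [set c : {ffun vertex n -> Z} | `[< Dcubes 1 (c : vertex n -> Z) >] ]%SET.

Definition is_uniform_image (R : realType) (Y : cfrNilspace R)
    (Z : finZmodType) (phi : Z -> Y) (n : nat) (P : cube_prob R n Y) : Prop :=
  forall A : set (cube_space n Y), borel_set A ->
    P A = ((#|[set c in group_cubes Z n | `[< A (phi \o c) >] ]%SET|%:R
            / #|group_cubes Z n|%:R)%:E)%R.

Definition is_balanced (R : realType) (Y : cfrNilspace R)
    (d : forall n, cube_prob R n Y -> cube_prob R n Y -> R)
    (Z : finZmodType) (b : R) (phi : Z -> Y) : Prop :=
  forall n, n%:R <= b^-1 -> exists P Q : cube_prob R n Y,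
    [/\ is_uniform_image phi P, is_cube_haar Q & d n P Q <= b].

(* The enumeration starts at index 1; index 0 is unused for it.  A j-step
   nilspace is also k-step for k > j, with Z_k trivial, and the conditions on
   the last structure group are stated for all these k. *)
Record fixedChoices (R : realType) := FixedChoices {
  Yenum : nat -> cfrNilspace R;
  Yenum_complete : forall X : cfrNilspace R,
    exists! i, (0 < i)%N /\ nil_iso X (Yenum i);
  Ysmooth : forall i, smoothStructure (Yenum i);
  Yriem : forall i, riemannianMetric (Ysmooth i);
  Ydist : forall i n, cube_prob R n (Yenum i) -> cube_prob R n (Yenum i) -> R;
  Ydist_weak : forall i n, is_weak_metric (@Ydist i n);
  Qof : nat -> R -> R -> nat;
  QofP : forall i k, (0 < i)%N -> (0 < k)%N -> is_step (nil_cubes (Yenum i)) k ->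
    forall C delta : R, 0 < C -> 0 < delta ->
    exists S : {fset (Zgrp (Yenum i) k -> R[i])},
      [/\ (forall chi, chi \in S -> is_character chi),
          (#|` S| <= Qof i delta C)%N &
          forall F, lipschitz_for (Yriem i) C F ->
            norm_inf_le (fun x => F x - \sum_(chi <- S) fourier_part F chi x) delta] }.

Definition Qmax (R : realType) (K : fixedChoices R) (eta : R) (m : nat) : nat :=
  (\max_(1 <= i < m.+1) Qof K i eta m%:R)%N.

Record regularityDecomposition (R : realType) (K : fixedChoices R) (k : nat)
    (eta : R) (D : R -> nat -> R) (Z : finZmodType) (f : Z -> R[i])
    (m : nat) := RegularityDecomposition {
  rd_index : nat;
  rd_Y := Yenum K rd_index;
  rd_complexity : (0 < rd_index <= m)%N;
  rd_step : is_step (nil_cubes rd_Y) k;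
  rd_phi : Z -> rd_Y;
  rd_morphism : nil_morphism (@Dcubes 1 Z) (nil_cubes rd_Y) rd_phi;
  rd_balanced : is_balanced (@Ydist R K rd_index) (D eta m) rd_phi;
  rd_F : rd_Y -> R[i];
  rd_F_bounded : norm_inf_le rd_F 1;
  rd_F_lipschitz : lipschitz_for (Yriem K rd_index) m%:R rd_F;
  rd_fs := rd_F \o rd_phi;
  rd_fe : Z -> R[i];
  rd_fr : Z -> R[i];
  rd_decomp : forall x, f x = rd_fs x + rd_fe x + rd_fr x;
  rd_fe_small : lpnorm 1 rd_fe <= eta;
  rd_fr_bounded : norm_inf_le rd_fr 1;
  rd_fr_gowers : gowers_norm k.+1 rd_fr <= D eta m;
  rd_fr_fs : cabs (inner rd_fr rd_fs) <= D eta m;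
  rd_fr_fe : cabs (inner rd_fr rd_fe) <= D eta m;
  rd_S : {fset (Zgrp rd_Y k -> R[i])};
  rd_S_char : forall chi, chi \in rd_S -> is_character chi;
  rd_S_card : (#|` rd_S| <= Qmax K eta m)%N;
  rd_g := fun chi : Zgrp rd_Y k -> R[i] => fourier_part rd_F chi \o rd_phi;
  rd_ge : Z -> R[i];
  rd_fs_decomp : forall x, rd_fs x = \sum_(chi <- rd_S) rd_g chi x + rd_ge x;
  rd_ge_small : norm_inf_le rd_ge eta;
  rd_orth : forall chi chi', chi \in rd_S -> chi' \in rd_S -> chi != chi' ->
    cabs (inner (rd_g chi) (rd_g chi')) <= D eta m;
  (* In [R[i]], [z <= x%:C] says that [z] is real and at most [x]. *)
  rd_gowers_orth : forall chi chi', chi \in rd_S -> chi' \in rd_S ->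
    chi != chi' -> gowers_inner k (rd_g chi) (rd_g chi') <= (D eta m)%:C%C }.

Arguments rd_S {R K k eta D Z f m} _.
Arguments rd_g {R K k eta D Z f m} _ _ _.
Arguments rd_fr {R K k eta D Z f m} _ _.

Definition regularity_bound (R : realType) (K : fixedChoices R) (k : nat)
    (N : R -> (R -> nat -> R) -> nat) : Prop :=
  forall (eta : R) (D : R -> nat -> R), 0 < eta ->
    (forall (e : R) (j : nat), 0 < e -> 0 < D e j) ->
  forall (Z : finZmodType) (f : Z -> R[i]), norm_inf_le f 1 ->
    exists2 m, (1 <= m <= N eta D)%N &
      inhabited (regularityDecomposition K k eta D f m).

(* Main.v *)
(* Expand |f|^2 with f = f_s + f_e + f_r. The terms <f_r, f_s> and <f_r, f_e>
   cost 4 D, the terms involving f_e cost 3 eta since |2 f_s + f_e| =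
   |f_s + f - f_r| <= 3, replacing f_s by the sum of the g_chi costs
   2 eta + eta^2, and the off-diagonal terms <g_chi, g_chi'> cost |S|^2 D.
   This gives the bound for eta <= 1.

   For eta >= 1 the term eta^2 is too large, but then it suffices that all
   three energies lie in [0, 1]. For the sum over chi this is Bessel's
   inequality for the characters of Z_k(Y), applied at each point x to
   z |-> F (x + z), whose Fourier coefficients are the F_chi (x). It needs
   z |-> F (x + z) to be Borel, so F must be continuous for the topology of Y:
   straight segments in a chart show that the geodesic distance to x tends
   to 0 at x, and F is Lipschitz for that distance. *)
Require Import Defs.
From HB Require Import structures.
From mathcomp Require Import all_boot all_order all_algebra.
From mathcomp Require Import finmap complex.
From mathcomp Require Import all_classical all_reals all_analysis.
From mathcomp Require Import measurable_realfun ring lra.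

Set Implicit Arguments.
Unset Strict Implicit.
Unset Printing Implicit Defensive.

Import Order.TTheory GRing.Theory Num.Theory.
Import numFieldNormedType.Exports.

Local Open Scope classical_set_scope.
Local Open Scope ring_scope.

(** * Averages over a finite group *)

Section Complex.
Context (R : realType).
Implicit Types z w : R[i].

Lemma cabs_ge0 z : 0 <= cabs z.
Proof. by case: z => a b; exact: sqrtr_ge0. Qed.

Lemma cabs_sqr z : cabs z ^+ 2 = complex.Re (z * conjc z).
Proof.
case: z => a b; rewrite /cabs /= sqr_sqrtr ?addr_ge0 ?sqr_ge0//.
by rewrite mulrN opprK -!expr2.
Qed.

Lemma cabs_conjc z : cabs (conjc z) = cabs z.
Proof. by case: z => a b; rewrite /cabs /= sqrrN. Qed.

Lemma cabsM z w : cabs (z * w) = cabs z * cabs w.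
Proof. exact: ComplexField.Normc.normcM. Qed.

Lemma ler_cabsD z w : cabs (z + w) <= cabs z + cabs w.
Proof. exact: le_normcD. Qed.

Lemma cabsN z : cabs (- z) = cabs z.
Proof. by case: z => a b; rewrite /cabs /= !sqrrN. Qed.

Lemma ler_Re_cabs z : `|complex.Re z| <= cabs z.
Proof.
case: z => a b; rewrite /cabs /= -sqrtr_sqr ler_wsqrtr// lerDl sqr_ge0//.
Qed.

Lemma ler_Im_cabs z : `|complex.Im z| <= cabs z.
Proof.
by case: z => a b; rewrite /cabs /= -sqrtr_sqr ler_wsqrtr// lerDr sqr_ge0.
Qed.

Lemma mulcJ z : z * conjc z = (cabs z ^+ 2)%:C%C.
Proof.
rewrite cabs_sqr; case: z => a b /=; congr Complex; ring.
Qed.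

Lemma cabs_sqrD z w :
  cabs (z + w) ^+ 2 = cabs z ^+ 2 + cabs w ^+ 2 + 2 * complex.Re (z * conjc w).
Proof. by rewrite !cabs_sqr; case: z w => a b [c d] /=; ring. Qed.

End Complex.

Section Average.
Context (R : realType) (Z : finZmodType).
Implicit Types (u v : Z -> R) (f g h : Z -> R[i]).

Let card_gt0 : 0 < #|Z|%:R :> R.
Proof. by rewrite ltr0n; apply/card_gt0P; exists 0. Qed.

Lemma avgD u v : avg (fun x => u x + v x) = avg u + avg v.
Proof. by rewrite /avg big_split mulrDl. Qed.

Lemma avgN u : avg (fun x => - u x) = - avg u.
Proof. by rewrite /avg sumrN mulNr. Qed.

Lemma avgM (a : R) u : avg (fun x => a * u x) = a * avg u.
Proof. by rewrite /avg -mulr_sumr mulrA. Qed.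

Lemma avg_sum (I : Type) (s : seq I) (u : I -> Z -> R) :
  avg (fun x => \sum_(i <- s) u i x) = \sum_(i <- s) avg (u i).
Proof. by rewrite /avg exchange_big mulr_suml. Qed.

Lemma ler_avg u v : (forall x, u x <= v x) -> avg u <= avg v.
Proof. by move=> uv; rewrite ler_pM2r ?invr_gt0//; exact: ler_sum. Qed.

Lemma avg_cst (a : R) : avg (fun _ : Z => a) = a.
Proof. by rewrite /avg sumr_const -[a *+ _]mulr_natr mulfK// gt_eqF. Qed.

Lemma avg_ge0 u : (forall x, 0 <= u x) -> 0 <= avg u.
Proof. by move=> u0; rewrite -[leLHS](avg_cst 0); exact: ler_avg. Qed.

Lemma ler_norm_avg u : `|avg u| <= avg (fun x => `|u x|).
Proof.
rewrite ler_norml -avgN; apply/andP; split; apply: ler_avg => x.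
  by rewrite lerNl -normrN ler_norm.
exact: ler_norm.
Qed.

(** The squared $L^2$ norm without real powers; [sqr_lpnorm2] links it to [lpnorm]. *)
Definition energy f : R := avg (fun x => cabs (f x) ^+ 2).

(** The real part of [inner f g], averaged in [R] so that the estimates become linear arithmetic
    over the reals. *)
Definition corr f g : R := avg (fun x => complex.Re (f x * conjc (g x))).

Lemma energy_ge0 f : 0 <= energy f.
Proof. by apply: avg_ge0 => x; exact: sqr_ge0. Qed.

Lemma sqr_lpnorm2 f : lpnorm 2 f ^+ 2 = energy f.
Proof.
rewrite /lpnorm (_ : avg _ = energy f); last first.
  by congr avg; apply/funext => x; rewrite powR_mulrn ?cabs_ge0.
by rewrite powR12_sqrt ?energy_ge0// sqr_sqrtr ?energy_ge0.
Qed.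

Lemma lpnorm1 f : lpnorm 1 f = avg (fun x => cabs (f x)).
Proof.
rewrite /lpnorm invr1 powRr1; last by apply: avg_ge0 => x; exact: powR_ge0.
by congr avg; apply/funext => x; rewrite powRr1 ?cabs_ge0.
Qed.

Lemma Re_inner f g : complex.Re (inner f g) = corr f g.
Proof.
(* The cardinal is the image of a real number, so dividing by it commutes with [complex.Re]. *)
rewrite /inner /avg -[#|Z|%:R in LHS](rmorph_nat (real_complex R)) -fmorphV.
rewrite [LHS](_ : _ = complex.Re (\sum_x f x * conjc (g x)) / #|Z|%:R); last first.
  by case: (\sum_x _) => a b; rewrite /= mulr0 subr0.
congr (_ / _); exact: (raddf_sum (@complex.Re R : {additive R[i] -> R})).
Qed.

Lemma ler_norm_corr f g : `|corr f g| <= cabs (inner f g).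
Proof. by rewrite -Re_inner; exact: ler_Re_cabs. Qed.

Lemma ler_norm_corr_avg (a b : Z -> R) f g : (forall x, cabs (f x) <= a x) ->
  (forall x, cabs (g x) <= b x) ->
  `|corr f g| <= avg (fun x => a x * b x).
Proof.
move=> fa gb; apply: le_trans (ler_norm_avg _) _; apply: ler_avg => x.
apply: le_trans (ler_Re_cabs _) _; rewrite cabsM cabs_conjc.
by apply: ler_pM => //; exact: cabs_ge0.
Qed.

End Average.

(** * Energies of sums and nearly orthogonal families *)

Section Energy.
Context (R : realType) (Z : finZmodType).
Implicit Types f g : Z -> R[i].

Lemma energyD f g : energy (fun x => f x + g x) = energy f + energy g + 2 * corr f g.
Proof.
by rewrite /energy /corr -avgM -!avgD; congr avg; apply/funext => x; rewrite cabs_sqrD.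
Qed.

Lemma energy_le1 f : norm_inf_le f 1 -> energy f <= 1.
Proof.
move=> f1; rewrite -[leRHS](avg_cst Z); apply: ler_avg => x.
by rewrite expr_le1// cabs_ge0.
Qed.

(** The square expands into the double sum of the correlations of [g i] and [g j]; the diagonal
    gives the energies, and the hypothesis on [inner] bounds every other term. *)
Lemma energy_sum (I : eqType) (s : seq I) (g : I -> Z -> R[i]) (d : R) : uniq s ->
  0 <= d ->
  (forall i j, i \in s -> j \in s -> i != j -> cabs (inner (g i) (g j)) <= d) ->
  `|energy (fun x => \sum_(i <- s) g i x) - \sum_(i <- s) energy (g i)|
     <= (size s)%:R ^+ 2 * d.
Proof.
move=> us d0 orth.
have -> : energy (fun x => \sum_(i <- s) g i x) =
    \sum_(i <- s) \sum_(j <- s) corr (g i) (g j).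
  rewrite /energy /corr; under eq_bigr do rewrite -avg_sum.
  rewrite -avg_sum; congr avg; apply/funext => x.
  rewrite cabs_sqr raddf_sum mulr_suml raddf_sum; apply: eq_bigr => i _.
  by rewrite mulr_sumr raddf_sum.
have -> : \sum_(i <- s) \sum_(j <- s) corr (g i) (g j) - \sum_(i <- s) energy (g i) =
    \sum_(i <- s) \sum_(j <- s | j != i) corr (g i) (g j).
  rewrite -sumrB; apply: eq_big_seq => i si.
  rewrite (bigD1_seq i)//= addrC (_ : corr (g i) (g i) = energy (g i)) ?addrK 1?addrC ?addKr//.
  by congr avg; apply/funext => x; rewrite cabs_sqr.
(* The diagonal positions are granted [d] as well, by [0 <= d], so that the count is a full
   square. *)
apply: (@le_trans _ _ (\sum_(i <- s) \sum_(j <- s) d)); last first.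
  by rewrite !big_const_seq !count_predT !iter_addr_0 -mulrnA -[leLHS]mulr_natl natrM expr2.
apply: le_trans (ler_norm_sum _ _ _) _; rewrite big_seq [leRHS]big_seq.
apply: ler_sum => i si; apply: le_trans (ler_norm_sum _ _ _) _.
rewrite big_mkcond/= big_seq [leRHS]big_seq; apply: ler_sum => j sj.
case: ifPn => // ji; apply: le_trans (ler_norm_corr _ _) _.
by apply: orth => //; rewrite eq_sym.
Qed.

End Energy.

(** Here [g] is an abstract nearly orthogonal family. In the final constant, [4 * d] comes from the
    two correlations with [fr], each counted twice, and [5 * eta] is [3 * eta] from [fe] plus
    [2 * eta] from [ge]. *)
Lemma energy_decomposition (R : realType) (Z : finZmodType) (I : eqType) (s : seq I)
    (f fs fe fr ge : Z -> R[i]) (g : I -> Z -> R[i]) (d eta : R) :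
  uniq s -> 0 <= d -> 0 <= eta ->
  norm_inf_le f 1 -> norm_inf_le fs 1 -> norm_inf_le fr 1 ->
  (forall x, f x = fs x + fe x + fr x) ->
  (forall x, fs x = \sum_(i <- s) g i x + ge x) ->
  lpnorm 1 fe <= eta -> norm_inf_le ge eta ->
  cabs (inner fr fs) <= d -> cabs (inner fr fe) <= d ->
  (forall i j, i \in s -> j \in s -> i != j -> cabs (inner (g i) (g j)) <= d) ->
  `|energy f - \sum_(i <- s) energy (g i) - energy fr|
    <= ((size s)%:R ^+ 2 + 4) * d + (5 * eta + eta ^+ 2).
Proof.
move=> us d0 eta0 f1 fs1 fr1 fE fsE fe1 ge1 frs fre orth.
(* The cross term of [fs + fe] with [fr] is additive in the first argument, and its real part is
   symmetric. *)
have fE' : energy f = energy (fun x => fs x + fe x) + energy fr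
    + 2 * corr fr fs + 2 * corr fr fe.
  rewrite (_ : energy f = energy (fun x => (fs x + fe x) + fr x)).
    rewrite energyD -!addrA; congr (_ + (_ + _)); rewrite -mulrDr /corr -avgD.
    congr (2 * _); congr avg; apply/funext => x.
    by case: (fs x) (fe x) (fr x) => ? ? [? ?] [? ?] /=; ring.
  by congr avg; apply/funext => x; rewrite fE.
(* [|fs + fe|^2 - |fs|^2 = Re (fe conj (2 fs + fe))], and [2 fs + fe = fs + f - fr]
   is bounded by 3. *)
have fse : `|energy (fun x => fs x + fe x) - energy fs| <= 3 * eta.
  have -> : energy (fun x => fs x + fe x) - energy fs
      = corr fe (fun x => fs x + f x - fr x).
    rewrite /energy /corr -avgN -avgD; congr avg; apply/funext => x.
    by rewrite fE !cabs_sqr; case: (fs x) (fe x) (fr x) => ? ? [? ?] [? ?] /=; ring.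
  apply: (@le_trans _ _ (avg (fun x => cabs (fe x) * 3))).
    apply: ler_norm_corr_avg => // x; apply: le_trans (ler_cabsD _ _) _.
    rewrite cabsN; apply: (@le_trans _ _ (1 + 1 + 1)); last by lra.
    apply: lerD (fr1 x); apply: le_trans (ler_cabsD _ _) _; exact: lerD.
  rewrite (_ : avg _ = 3 * lpnorm 1 fe) ?ler_wpM2l//.
  by rewrite lpnorm1 -avgM; congr avg; apply/funext => x; rewrite mulrC.
(* [|fs|^2 - |G|^2 = Re (ge conj (2 fs - ge))] for [G = fs - ge]. *)
have fsG : `|energy fs - energy (fun x => \sum_(i <- s) g i x)| <= 2 * eta + eta ^+ 2.
  have -> : energy fs - energy (fun x => \sum_(i <- s) g i x)
      = corr ge (fun x => fs x + fs x - ge x).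
    rewrite /energy /corr -avgN -avgD; congr avg; apply/funext => x.
    rewrite (_ : \sum_(i <- s) g i x = fs x - ge x); last by rewrite fsE addrK.
    by rewrite !cabs_sqr; case: (fs x) (ge x) => ? ? [? ?] /=; ring.
  apply: (@le_trans _ _ (avg (fun _ : Z => eta * (1 + 1 + eta)))).
    apply: ler_norm_corr_avg => // x; apply: le_trans (ler_cabsD _ _) _.
    rewrite cabsN; apply: lerD (ge1 x); apply: le_trans (ler_cabsD _ _) _; exact: lerD.
  by rewrite avg_cst; lra.
have Gg := energy_sum us d0 orth.
have /ler_normlP[s1 s2] := le_trans (ler_norm_corr _ _) frs.
have /ler_normlP[e1 e2] := le_trans (ler_norm_corr _ _) fre.
have [/ler_normlP[a1 a2] /ler_normlP[b1 b2] /ler_normlP[c1 c2]] := And3 fse fsG Gg.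
by rewrite fE'; apply/ler_normlP; split; lra.
Qed.

(** * Bessel's inequality for characters *)

Section Bessel.
Context d (T : measurableType d) (R : realType) (mu : probability T R).
Implicit Types f g : T -> R[i].

(** [cintegral] integrates the two components separately, so measurability is asked of each; a
    uniform bound gives integrability for a probability measure. *)
Definition bounded_measurable f : Prop :=
  [/\ measurable_fun setT (fun x => complex.Re (f x)),
      measurable_fun setT (fun x => complex.Im (f x)) &
      exists M, forall x, cabs (f x) <= M].

Lemma bounded_integrable (u : T -> R) M : measurable_fun setT u ->
  (forall x, `|u x| <= M) -> mu.-integrable setT (EFin \o u).
Proof.
have muT : (mu setT < +oo)%E by rewrite probability_setT ltry.
move=> mu_ bu; apply: (measurable_bounded_integrable _ muT) => //.
exists M; split; rewrite ?num_real// => y My x _ /=.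
exact: le_trans (bu x) (ltW My).
Qed.

Lemma integrable_Re f : bounded_measurable f ->
  mu.-integrable setT (EFin \o (fun x => complex.Re (f x))).
Proof.
move=> [mR _ [M fM]]; apply: (bounded_integrable mR (M := M)) => x.
exact: le_trans (ler_Re_cabs _) (fM x).
Qed.

Lemma integrable_Im f : bounded_measurable f ->
  mu.-integrable setT (EFin \o (fun x => complex.Im (f x))).
Proof.
move=> [_ mI [M fM]]; apply: (bounded_integrable mI (M := M)) => x.
exact: le_trans (ler_Im_cabs _) (fM x).
Qed.

Lemma bounded_measurable_cst (a : R[i]) : bounded_measurable (cst a).
Proof. by split; [exact: measurable_cst|exact: measurable_cst|exists (cabs a)]. Qed.

Lemma bounded_measurableD f g : bounded_measurable f -> bounded_measurable g ->
  bounded_measurable (fun x => f x + g x).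
Proof.
move=> [fR fI [M fM]] [gR gI [N gN]]; split.
- rewrite (_ : (fun x => _) = (fun x => complex.Re (f x)) \+ (fun x => complex.Re (g x))).
    exact: measurable_funD.
  by apply/funext => x /=; case: (f x) (g x) => ? ? [].
- rewrite (_ : (fun x => _) = (fun x => complex.Im (f x)) \+ (fun x => complex.Im (g x))).
    exact: measurable_funD.
  by apply/funext => x /=; case: (f x) (g x) => ? ? [].
- by exists (M + N) => x; apply: le_trans (ler_cabsD _ _) _; exact: lerD.
Qed.

Lemma bounded_measurableM f g : bounded_measurable f -> bounded_measurable g ->
  bounded_measurable (fun x => f x * g x).
Proof.
move=> [fR fI [M fM]] [gR gI [N gN]]; split.
- rewrite (_ : (fun x => _) = ((fun x => complex.Re (f x)) \* (fun x => complex.Re (g x)))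
     \- ((fun x => complex.Im (f x)) \* (fun x => complex.Im (g x)))).
    by apply: measurable_funB; exact: measurable_funM.
  by apply/funext => x /=; case: (f x) (g x) => ? ? [].
- rewrite (_ : (fun x => _) = ((fun x => complex.Re (f x)) \* (fun x => complex.Im (g x)))
     \+ ((fun x => complex.Im (f x)) \* (fun x => complex.Re (g x)))).
    by apply: measurable_funD; exact: measurable_funM.
  by apply/funext => x /=; case: (f x) (g x) => ? ? [].
- by exists (M * N) => x; rewrite cabsM; apply: ler_pM => //; exact: cabs_ge0.
Qed.

Lemma bounded_measurableJ f : bounded_measurable f ->
  bounded_measurable (fun x => conjc (f x)).
Proof.
move=> [fR fI [M fM]]; split.
- rewrite (_ : (fun x => _) = (fun x => complex.Re (f x)))//.
  by apply/funext => x /=; case: (f x).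
- rewrite (_ : (fun x => _) = \- (fun x => complex.Im (f x))).
    exact: measurable_funN.
  by apply/funext => x /=; case: (f x).
- by exists M => x; rewrite cabs_conjc.
Qed.

Lemma bounded_measurable_sum (I : eqType) (s : seq I) (F : I -> T -> R[i]) :
  (forall i, i \in s -> bounded_measurable (F i)) ->
  bounded_measurable (fun x => \sum_(i <- s) F i x).
Proof.
elim: s => [|i s IH] bF.
  rewrite (_ : (fun x => _) = cst 0); first exact: bounded_measurable_cst.
  by apply/funext => x; rewrite big_nil.
rewrite (_ : (fun x => _) = (fun x => F i x + \sum_(i <- s) F i x)).
  apply: bounded_measurableD; first by apply: bF; rewrite mem_head.
  by apply: IH => j js; apply: bF; rewrite inE js orbT.
by apply/funext => x; rewrite big_cons.
Qed.

Lemma cintegralD f g : bounded_measurable f -> bounded_measurable g ->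
  cintegral mu (fun x => f x + g x) = cintegral mu f + cintegral mu g.
Proof.
move=> bf bg; rewrite /cintegral [RHS]/= /GRing.add /=.
congr Complex; rewrite -RintegralD//; try exact: integrable_Re; try exact: integrable_Im.
- by apply: eq_Rintegral => x _; case: (f x) (g x) => ? ? [].
- by apply: eq_Rintegral => x _; case: (f x) (g x) => ? ? [].
Qed.

Lemma cintegralZ (a : R[i]) f : bounded_measurable f ->
  cintegral mu (fun x => a * f x) = a * cintegral mu f.
Proof.
move=> bf; case: a => a b; rewrite /cintegral.
rewrite [RHS](_ : _ = Complex (a * \int[mu]_x complex.Re (f x) - b * \int[mu]_x complex.Im (f x))
  (a * \int[mu]_x complex.Im (f x) + b * \int[mu]_x complex.Re (f x)))//.
have iR := integrable_Re bf; have iI := integrable_Im bf.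
have iZ c u : mu.-integrable setT (EFin \o u) ->
    mu.-integrable setT (EFin \o (fun x => c * u x)).
  move=> iu; rewrite (_ : _ \o _ = (fun x => c%:E * (EFin \o u) x)%E)//.
  exact: integrableZl.
congr Complex.
- rewrite -!RintegralZl// -RintegralB//; try exact: iZ.
  by apply: eq_Rintegral => x _; case: (f x).
- rewrite -!RintegralZl// -RintegralD//; try exact: iZ.
  by apply: eq_Rintegral => x _; case: (f x).
Qed.

Lemma cintegralJ f : bounded_measurable f ->
  cintegral mu (fun x => conjc (f x)) = conjc (cintegral mu f).
Proof.
move=> bf; rewrite /cintegral /=; congr Complex.
  by apply: eq_Rintegral => x _; case: (f x).
rewrite -mulN1r -RintegralZl//; last exact: integrable_Im.
by apply: eq_Rintegral => x _; case: (f x) => ? ?; rewrite mulN1r.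
Qed.

Lemma cintegral_cst (a : R[i]) : cintegral mu (cst a) = a.
Proof.
case: a => a b; rewrite /cintegral /cst /= !(Rintegral_cst mu)//.
have muT : fine (mu setT) = 1 :> R by rewrite probability_setT.
by rewrite -[in RHS](mulr1 a) -[in RHS](mulr1 b) -muT.
Qed.

Lemma eq_cintegral f g : f =1 g -> cintegral mu f = cintegral mu g.
Proof. by move=> /funext ->. Qed.

Lemma cintegral_sum (I : eqType) (s : seq I) (F : I -> T -> R[i]) :
  (forall i, i \in s -> bounded_measurable (F i)) ->
  cintegral mu (fun x => \sum_(i <- s) F i x) = \sum_(i <- s) cintegral mu (F i).
Proof.
elim: s => [|i s IH] bF.
  by rewrite big_nil -[RHS](cintegral_cst 0); apply: eq_cintegral => x; rewrite big_nil.
have bF' j : j \in s -> bounded_measurable (F j).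
  by move=> js; apply: bF; rewrite inE js orbT.
rewrite big_cons -IH// -cintegralD; first last.
- exact: bounded_measurable_sum.
- by apply: bF; rewrite mem_head.
by apply: eq_cintegral => x; rewrite big_cons.
Qed.

Lemma ler_Re_cintegral f (a : R) : bounded_measurable f ->
  (forall x, complex.Re (f x) <= a) -> complex.Re (cintegral mu f) <= a.
Proof.
move=> bf fa; have muT : fine (mu setT) = 1 :> R by rewrite probability_setT.
rewrite -[leRHS]mulr1 -muT -(Rintegral_cst mu)//.
apply: le_Rintegral => //; first exact: integrable_Re.
by apply: (bounded_integrable (M := `|a|)).
Qed.

Lemma Re_cintegral_ge0 f : (forall x, 0 <= complex.Re (f x)) ->
  0 <= complex.Re (cintegral mu f).
Proof. by move=> f0; apply: Rintegral_ge0. Qed.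

(** Let [p] be the orthogonal projection of [h] on the span of the [e i], and [N] the sum to be
    bounded. The integral of [|h - p|^2] is nonnegative and equals that of [|h|^2], which is at most
    [1], minus [N]. *)
Lemma bessel (I : eqType) (s : seq I) (e : I -> T -> R[i]) (h : T -> R[i]) :
  uniq s ->
  (forall i, i \in s -> bounded_measurable (e i)) -> bounded_measurable h ->
  (forall i j, i \in s -> j \in s ->
     cintegral mu (fun x => e i x * conjc (e j x)) = (i == j)%:R) ->
  (forall x, cabs (h x) <= 1) ->
  \sum_(i <- s) cabs (cintegral mu (fun x => h x * conjc (e i x))) ^+ 2 <= 1.
Proof.
move=> us be bh orth h1.
pose a i := cintegral mu (fun x => h x * conjc (e i x)).
pose p x := \sum_(i <- s) a i * e i x.
have bae i : i \in s -> bounded_measurable (fun x => a i * e i x).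
  by move=> si; apply: bounded_measurableM; [exact: bounded_measurable_cst|exact: be].
have bp : bounded_measurable p by exact: bounded_measurable_sum.
set N := \sum_(i <- s) _.
have pJ x : conjc (p x) = \sum_(i <- s) conjc (a i) * conjc (e i x).
  by rewrite /p raddf_sum; apply: eq_bigr => i _; rewrite /= rmorphM.
(* Conjugate-linearity in the second slot, stated for any [u] since it serves for both [h] and the
   [e i]. *)
have cross (u : T -> R[i]) : bounded_measurable u ->
    cintegral mu (fun x => u x * conjc (p x)) =
    \sum_(i <- s) conjc (a i) * cintegral mu (fun x => u x * conjc (e i x)).
  move=> bu.
  have bue i : i \in s -> bounded_measurable (fun x => u x * conjc (e i x)).
    by move=> si; apply: bounded_measurableM => //; apply: bounded_measurableJ; exact: be.
  transitivity (\sum_(i <- s) cintegral mu (fun x => conjc (a i) * (u x * conjc (e i x)))).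
    rewrite -cintegral_sum.
      apply: eq_cintegral => x; rewrite pJ mulr_sumr; apply: eq_bigr => i _.
      by rewrite mulrCA.
    by move=> i si; apply: bounded_measurableM; [exact: bounded_measurable_cst|exact: bue].
  by apply: eq_big_seq => i si; rewrite cintegralZ//; exact: bue.
have hp : cintegral mu (fun x => h x * conjc (p x)) = N%:C%C.
  rewrite cross// /N rmorph_sum/=; apply: eq_bigr => i _.
  by rewrite -/(a i) mulrC mulcJ.
have ep i : i \in s -> cintegral mu (fun x => e i x * conjc (p x)) = conjc (a i).
  move=> si; rewrite cross; last exact: be.
  rewrite (bigD1_seq i)//= orth// eqxx mulr1 big_seq_cond big1 ?addr0// => j /andP[js ji].
  by rewrite orth// eq_sym (negbTE ji) mulr0.
have pp : cintegral mu (fun x => p x * conjc (p x)) = N%:C%C.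
  have bep i : i \in s -> bounded_measurable (fun x => e i x * conjc (p x)).
    by move=> si; apply: bounded_measurableM; [exact: be|exact: bounded_measurableJ].
  rewrite (eq_cintegral (g := fun x => \sum_(i <- s) a i * (e i x * conjc (p x)))); last first.
    by move=> x; rewrite {1}/p mulr_suml; apply: eq_bigr => i _; rewrite mulrA.
  rewrite cintegral_sum; last first.
    by move=> i si; apply: bounded_measurableM; [exact: bounded_measurable_cst|exact: bep].
  rewrite /N rmorph_sum/=; apply: eq_big_seq => i si.
  by rewrite cintegralZ ?ep ?mulcJ//; exact: bep.
have bhh : bounded_measurable (fun x => h x * conjc (h x)).
  by apply: bounded_measurableM => //; exact: bounded_measurableJ.
have bhp : bounded_measurable (fun x => h x * conjc (p x)).
  by apply: bounded_measurableM => //; exact: bounded_measurableJ.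
have bpp : bounded_measurable (fun x => p x * conjc (p x)).
  by apply: bounded_measurableM => //; exact: bounded_measurableJ.
have hh1 : complex.Re (cintegral mu (fun x => h x * conjc (h x))) <= 1.
  apply: ler_Re_cintegral => // x; rewrite -cabs_sqr.
  by rewrite expr_le1// cabs_ge0.
suff : 0 <= complex.Re (cintegral mu (fun x => h x * conjc (h x))) - N by lra.
have := Re_cintegral_ge0 (f := fun x => (h x - p x) * conjc (h x - p x)).
rewrite (_ : cintegral mu _ = cintegral mu (fun x => h x * conjc (h x)) - N%:C%C).
  move=> /(_ _)/le_trans; apply; first by move=> x; rewrite -cabs_sqr sqr_ge0.
  by case: (cintegral mu _) => ? ?.
(* The second cross term is written as the conjugate of the first, so that both integrate to [- N],
   [N] being real; the four terms add up to the integral of [|h|^2] plus [- N - N + N]. *)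
rewrite (eq_cintegral (g := fun x => (h x * conjc (h x) + -1 * (h x * conjc (p x))) +
   (-1 * conjc (h x * conjc (p x)) + p x * conjc (p x)))); last first.
  by move=> x; rewrite !rmorphB !rmorphM /= conjcK; ring.
have bN u : bounded_measurable u -> bounded_measurable (fun x => -1 * u x).
  by move=> bu; apply: bounded_measurableM => //; exact: bounded_measurable_cst.
have bhpJ := bounded_measurableJ bhp.
rewrite !cintegralD ?cintegralZ ?cintegralJ ?hp ?pp; try by [exact: bN|idtac].
  by rewrite conjc_real; ring.
all: by apply: bounded_measurableD => //; exact: bN.
Qed.

End Bessel.

(** * Haar measure and orthogonality of characters *)

Section Haar.
Context (R : realType) (G : topologicalZmodType)
  (mu : probability (borel (pgroup G)) R).

Lemma measurable_continuous (f : G -> R) : continuous (f : G -> R^o) ->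
  measurable_fun setT (f : borel (pgroup G) -> R).
Proof.
move=> /continuousP cf; apply: (measurability _ (RGenOpens.measurableE R)).
move=> _ [_ [a [b ->] <-]]; rewrite setTI; apply: sub_sigma_algebra.
by apply: cf; exact: interval_open.
Qed.

Lemma borel_translate (a : G) (A : set G) : borel_set A ->
  borel_set [set x | A (x + a)].
Proof.
have ca : continuous (fun x : G => x + a).
  move=> x; apply: (@continuous_comp _ _ _ (fun x : G => (x, a)) (fun p => p.1 + p.2)).
    by apply: cvg_pair; [exact: cvg_id|exact: cvg_cst].
  exact: add_continuous.
have mt : measurable_fun setT ((fun x => x + a) : borel (pgroup G) -> borel (pgroup G)).
  apply: (@measurability _ _ (borel (pgroup G)) (borel (pgroup G)) _ _
    (@open (pgroup G))) => //.
  move=> _ [B oB <-]; rewrite setTI; apply: sub_sigma_algebra.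
  by apply: (@open_comp _ _ (fun x : G => x + a)) => // x _; exact: ca.
by move=> bA; have := mt measurableT A bA; rewrite setTI.
Qed.

Context (haar : is_haar mu).

(** [is_haar] speaks of sets. The image of [mu] under translation by [a] agrees with [mu] on Borel
    sets, and a change of variables carries this to integrals. *)
Lemma Rintegral_translate (a : G) (f : G -> R) M :
  measurable_fun setT (f : borel (pgroup G) -> R) -> (forall x, `|f x| <= M) ->
  \int[mu]_x f (x + a) = \int[mu]_x f x.
Proof.
move=> mf fM.
pose phi : borel (pgroup G) -> borel (pgroup G) := fun x => x + a.
have mphi : measurable_fun setT phi.
  by move=> _ A bA; rewrite setTI; exact: (borel_translate a bA).
rewrite /Rintegral; congr fine.
have intf : mu.-integrable setT (EFin \o f) by exact: bounded_integrable mf fM.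
have mfphi : measurable_fun setT (f \o phi) by exact: measurableT_comp.
have intfp : mu.-integrable (phi @^-1` setT) ((EFin \o f) \o phi).
  by rewrite preimage_setT; apply: (bounded_integrable mu mfphi (M := M)) => x; exact: fM.
rewrite -(integral_pushforward mphi _ intfp)//; last first.
  by apply/measurable_EFinP.
apply: eq_measure_integral => //= A mA _.
by rewrite /pushforward; exact: (haar a mA).
Qed.

Lemma cintegral_translate (a : G) (f : G -> R[i]) :
  bounded_measurable (f : borel (pgroup G) -> R[i]) ->
  cintegral mu (fun x => f (x + a)) = cintegral mu f.
Proof.
move=> [fR fI [M fM]]; rewrite /cintegral; congr Complex.
  apply: (Rintegral_translate a (M := M)) => // x.
  exact: le_trans (ler_Re_cabs _) (fM x).
apply: (Rintegral_translate a (M := M)) => // x.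
exact: le_trans (ler_Im_cabs _) (fM x).
Qed.

Lemma character_bounded_measurable (chi : G -> R[i]) : is_character chi ->
  bounded_measurable (chi : borel (pgroup G) -> R[i]).
Proof.
move=> [_ chi1 cR cI]; split; [exact: measurable_continuous|exact: measurable_continuous|].
by exists 1 => x; rewrite chi1.
Qed.

(** For distinct characters pick [a] with [chi a != chi' a]. Translation by [a] multiplies the
    integral by [chi a * conjc (chi' a)], which differs from [1], yet leaves it unchanged; so the
    integral is zero. *)
Lemma character_orthonormal (chi chi' : G -> R[i]) :
  is_character chi -> is_character chi' ->
  cintegral mu (fun x => chi x * conjc (chi' x)) = (chi == chi')%:R.
Proof.
move=> Hchi Hchi'; have [chiM chi1 _ _] := Hchi; have [chiM' chi1' _ _] := Hchi'.
have unit1 (u : G -> R[i]) x : (forall y, cabs (u y) = 1) -> u x * conjc (u x) = 1.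
  by move=> u1; rewrite mulcJ u1 expr1n.
have [<-|neq] := eqVneq chi chi'.
  rewrite (eq_cintegral _ (g := cst 1)) ?cintegral_cst// => x.
  exact: unit1.
have [a chia] : exists a, chi a != chi' a.
  apply/not_existsP => h; move/eqP: neq; apply; apply/funext => a.
  by apply/eqP; have /negP := h a; rewrite negbK.
have bp : bounded_measurable ((fun x => chi x * conjc (chi' x)) : borel (pgroup G) -> R[i]).
  apply: bounded_measurableM; first exact: character_bounded_measurable.
  by apply: bounded_measurableJ; exact: character_bounded_measurable.
set c := cintegral _ _.
have : c = chi a * conjc (chi' a) * c.
  rewrite -cintegralZ// {1}/c -(cintegral_translate a bp).
  by apply: eq_cintegral => x; rewrite chiM chiM' rmorphM /=; ring.
move/eqP; rewrite -subr_eq0 -{1}[c]mul1r -mulrBl mulf_eq0 => /orP[|/eqP//].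
(* A factor equal to [1] would force [chi a = chi' a], because [conjc (chi' a)] is the inverse of
   [chi' a]. *)
rewrite subr_eq0 => /eqP h; case/eqP: chia.
by rewrite -[RHS]mul1r h -mulrA (mulrC _ (chi' a)) unit1// mulr1.
Qed.

Lemma bessel_characters (S : {fset (G -> R[i])}) (h : G -> R[i]) :
  (forall chi, chi \in S -> is_character chi) ->
  bounded_measurable (h : borel (pgroup G) -> R[i]) ->
  (forall x, cabs (h x) <= 1) ->
  \sum_(chi <- S) cabs (cintegral mu (fun x => h x * conjc (chi x))) ^+ 2 <= 1.
Proof.
move=> Schar bh h1.
have := @bessel _ _ R mu _ (enum_fset S) (fun chi => chi) h (fset_uniq S).
apply=> //.
- by move=> chi /Schar; exact: character_bounded_measurable.
- by move=> chi chi' /Schar ? /Schar ?; exact: character_orthonormal.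
Qed.

End Haar.

(** * Continuity of Lipschitz functions *)

Section Continuity.
Context (R : realType).

Lemma is_diff_affine (n : nat) (a b : 'rV[R]_n) (t : R^o) :
  is_diff t ((fun t => a + t *: b) : R^o -> 'rV[R]_n) ( *:%R^~ b).
Proof.
(* [cst 0] is the differential of the constant [a], which gives the sum the shape of [is_diffD]. *)
have -> : ( *:%R^~ b : R^o -> 'rV[R]_n) = cst 0 + *:%R^~ b.
  by apply/funext => x; rewrite /GRing.add /= add0r.
exact: (is_diffD (f := cst a)).
Qed.

Lemma derive_affine (n : nat) (a b : 'rV[R]_n) (v t : R^o) :
  'D_v ((fun t => a + t *: b) : R^o -> 'rV[R]_n) t = v *: b.
Proof.
have h := is_diff_affine a b t.
by rewrite deriveE ?diff_val//; exact: ex_diff.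
Qed.

Lemma continuous_affine (n : nat) (a b : 'rV[R]_n) (t : R^o) :
  {for t, continuous ((fun t => a + t *: b) : R^o -> 'rV[R]_n)}.
Proof.
apply: differentiable_continuous.
by have h := is_diff_affine a b t; exact: ex_diff.
Qed.

(** The derivative along [v] is the constant [v *: b], again affine but with slope [0]; hence the
    induction is over all [a] and [b]. *)
Lemma Cn_on_affine (n m : nat) (a b : 'rV[R]_n) :
  Cn_on m setT ((fun t => a + t *: b) : R^o -> 'rV[R]_n).
Proof.
elim: m a b => [|m IH] a b.
  by split; [move=> t _; exact: continuous_affine|].
split; [by move=> t _; exact: continuous_affine|].
split=> [t _|v]; first by have h := is_diff_affine a b t; exact: ex_diff.
rewrite (_ : (fun x => _) = (fun t => v *: b + t *: 0)); first exact: IH.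
by apply/funext => t; rewrite derive_affine scaler0 addr0.
Qed.

(** Since this bounds the set of lengths below, the infimum in [geodesic_dist] is at most each
    length. *)
Lemma path_length_ge0 (Y : cfrNilspace R) (S : smoothStructure Y)
    (g : riemannianMetric S) x y l : path_length g x y l -> 0 <= l.
Proof.
elim=> // c gam z l' _ _ _ _ l0; apply: addr_ge0 => //.
by apply: Rintegral_ge0 => t _; exact: sqrtr_ge0.
Qed.

(* The Lebesgue integral of a nonnegative function is a supremum over simple
   functions below it, so monotonicity needs no measurability. *)
Lemma Rintegral_itv01_le (h : R -> R) (B : R) : 0 <= B ->
  (forall t, 0 <= t <= 1 -> 0 <= h t <= B) ->
  \int[@lebesgue_measure R]_(t in `[0, 1]) h t <= B.
Proof.
move=> B0 hB; rewrite /Rintegral.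
have hI t : (`[0, 1]%classic : set R) t -> 0 <= t <= 1.
  by rewrite /= in_itv.
have leB : (\int[@lebesgue_measure R]_(t in `[0%R, 1%R]) (h t)%:E <=
            \int[@lebesgue_measure R]_(t in `[0%R, 1%R]) (cst B%:E) t)%E.
  rewrite !ge0_integralE; first last.
  - by move=> t /hI /hB /andP[]; rewrite lee_fin.
  - by move=> t _; rewrite lee_fin.
  apply: ereal_sup_le => _ [s sh <-]; exists s => // t; apply: le_trans (sh t) _.
  rewrite /patch; case: ifPn => // /set_mem /hI /hB /andP[_].
  by rewrite lee_fin.
move: leB; rewrite integral_cst//= lebesgue_measure_itv/= lte_fin ltr01 oppr0.
rewrite adde0 mule1 => leB.
rewrite -[leRHS]/(fine B%:E); apply: fine_le => //.
(* Finiteness, required by [fine_le], holds because the integral is nonnegative and at most [B]. *)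
rewrite ge0_fin_numE; first exact: le_lt_trans leB (ltry _).
by apply: integral_ge0 => t /hI /hB /andP[]; rewrite lee_fin.
Qed.

(** Bounding entrywise, with the maximum norm on [b], gives [n^2 * M * |b|^2]. Replacing [M] by the
    larger [(M + 1)^2] makes this a square, so that the square root in [segment_length] gets a bound
    linear in [|b|]. *)
Lemma quadratic_form_le (n : nat) (A : 'M[R]_n) (b : 'rV[R]_n) (M : R) : 0 <= M ->
  (forall i j, `|A i j| <= M) ->
  (b *m A *m b^T) 0 0 <= (n%:R * (M + 1) * `|b|) ^+ 2.
Proof.
move=> M0 hA; have hb i : `|b 0 i| <= `|b|.
  rewrite [leRHS]/Num.Def.normr /= mx_normrE.
  by apply/bigmax_geP; right => /=; exists (0, i).
apply: (@le_trans _ _ (\sum_(j < n) \sum_(i < n) `|b| * M * `|b|)).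
  rewrite mxE; apply: ler_sum => j _; rewrite !mxE mulr_suml; apply: ler_sum => i _.
  apply: le_trans (ler_norm _) _; rewrite !normrM.
  by rewrite !ler_pM ?mulr_ge0.
rewrite !sumr_const !card_ord.
rewrite [leLHS](_ : _ = (n%:R * `|b|) ^+ 2 * M); last by ring.
rewrite [leRHS](_ : _ = (n%:R * `|b|) ^+ 2 * (M + 1) ^+ 2); last by ring.
apply: ler_wpM2l; first exact: sqr_ge0.
have := sqr_ge0 M; nra.
Qed.

(** The image of the segment is connected and contains both end points. This rules out the [else]
    branch of [geodesic_dist]. *)
Lemma connected_component_segment (T : topologicalType) (n : nat) (p : 'rV[R]_n -> T)
    (a b : 'rV[R]_n) :
  (forall t, 0 <= t <= 1 -> {for a + t *: b, continuous p}) ->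
  connected_component [set: T] (p a) (p (a + b)).
Proof.
move=> pc.
have I01 : connected (`[0, 1]%classic : set R).
  by apply/connected_intervalP; exact: interval_is_interval.
have pI : {within (`[0, 1]%classic : set R), continuous (fun t => p (a + t *: b))}.
  apply: continuous_in_subspaceT => t /set_mem; rewrite /= in_itv /= => t01.
  apply: (@continuous_comp _ _ _ (fun t : R^o => a + t *: b) p); last exact: pc.
  exact: continuous_affine.
apply: (connected_component_max _ _ (connected_continuous_connected I01 pI)) => //.
- by exists 0; rewrite /= ?in_itv/= ?lexx ?ler01// scale0r addr0.
- by exists 1; rewrite /= ?in_itv/= ?lexx ?ler01// scale1r.
Qed.

(** * Geodesic distance inside one chart *)

Section Chart.
Context (Y : cfrNilspace R) (S : smoothStructure Y) (g : riemannianMetric S).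

(** The straight segment is an admissible path with constant velocity [b], and the bound [M] on the
    tensor controls its length. *)
Lemma geodesic_dist_segment_le c (a b : 'rV[R]_(ss_dim S)) (M : R) : 0 <= M ->
  ss_atlas c ->
  (forall t, 0 <= t <= 1 -> chart_cod c (a + t *: b)) ->
  (forall t, 0 <= t <= 1 -> forall i j,
     `|tensor g c (param c (a + t *: b)) i j| <= M) ->
  geodesic_dist g (param c a) (param c (a + b)) <= (ss_dim S)%:R * (M + 1) * `|b|.
Proof.
move=> M0 Ac cod bdT; have [ch _ _] := ss_atlasP S; have chc := ch _ Ac.
pose gam (t : R) := a + t *: b.
have gam0 : gam 0 = a by rewrite /gam scale0r addr0.
have gam1 : gam 1 = a + b by rewrite /gam scale1r.
rewrite /geodesic_dist; case: ifPn => [_|/asboolPn[]]; last first.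
  by apply: connected_component_segment => t t01; apply: (param_cont chc); exact: cod.
(* One smooth piece followed by the empty path, whence the [+ 0]. *)
have pl : path_length g (param c a) (param c (a + b)) (segment_length g c gam + 0).
  rewrite -[in param c a]gam0; apply: PathCons => //.
  - by split; [exact: openT|move=> m; exact: Cn_on_affine].
  - by rewrite gam1; exact: PathNil.
apply: (@le_trans _ _ (segment_length g c gam + 0)).
  by apply: ge_inf => //; exists 0 => l; exact: path_length_ge0.
have B0 : 0 <= (ss_dim S)%:R * (M + 1) * `|b| by rewrite !mulr_ge0// addr_ge0.
rewrite addr0; apply: Rintegral_itv01_le => // t t01.
rewrite sqrtr_ge0 /= -[leRHS]ger0_norm// -sqrtr_sqr ler_wsqrtr//.
by rewrite derive_affine scale1r; apply: quadratic_form_le => // i j; exact: bdT.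
Qed.

(** Near [x], a chart with bounded tensor makes the distance from [x] at most a constant times the
    coordinate difference, which tends to [0] since the chart is continuous. *)
Lemma lipschitz_for_continuous (L : R) (F : Y -> R[i]) : 0 <= L ->
  lipschitz_for g L F ->
  forall x e, 0 < e -> \forall y \near x, cabs (F x - F y) < e.
Proof.
move=> L0 lipF x e e0.
have [ch cov _] := ss_atlasP S; have [c Ac cx] := cov x; have chc := ch _ Ac.
pose u := Defs.coord c x; have cu : chart_cod c u by exact: coord_in.
(* The [+ 1] makes [M] strictly larger than each entry at [u], so by continuity it still dominates
   the entries near [u]. *)
pose M := \sum_i \sum_j `|tensor g c (param c u) i j| + 1.
have M0 : 0 <= M by rewrite addr_ge0// sumr_ge0// => i _; rewrite sumr_ge0.
have bdM : \forall w \near u, forall i j, `|tensor g c (param c w) i j| <= M.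
  suff bdMij i j : \forall w \near u, `|tensor g c (param c w) i j| <= M.
    apply: (@filter_forall _ _ _ _ (nbhs_filter u)) => i.
    apply: (@filter_forall _ _ _ _ (nbhs_filter u)) => j.
    exact: bdMij.
  have Tc : {for u, continuous (fun u => tensor g c (param c u) i j : R^o)}.
    (* Smoothness of order [0] is continuity. *)
    by have [_ /(_ 0%N)[/(_ _ cu)]] := tensor_smooth g Ac i j.
  have : `|tensor g c (param c u) i j : R^o| < M.
    apply: (@le_lt_trans _ _ (\sum_i \sum_j `|tensor g c (param c u) i j|)); last by rewrite ltrDl.
    rewrite (bigD1 i)//= (bigD1 j)//= -addrA lerDl addr_ge0//; first exact: sumr_ge0.
    by apply: sumr_ge0 => k _; exact: sumr_ge0.
  move=> lt; near do apply: ltW.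
  have nc : {for u, continuous (fun u => `|tensor g c (param c u) i j : R^o|)}.
    by apply: (continuous_comp Tc); exact: norm_continuous.
  exact: (cvgr_lt _ nc _ lt).
have codN : \forall w \near u, chart_cod c w.
  by apply: open_nbhs_nbhs; split => //; exact: chart_cod_open.
(* A ball is convex, so the segment from [u] to any of its points stays where both conditions
   hold. *)
have [r r0 rP] : exists2 r : R, 0 < r & forall w, `|w - u| < r ->
    chart_cod c w /\ forall i j, `|tensor g c (param c w) i j| <= M.
  have [r /= r0 rP] := (nbhs_ballP _ _).1 (filterI codN bdM).
  by exists r => // w wr; apply: rP; rewrite mx_norm_ball /ball_/= distrC.
pose C := L * ((ss_dim S)%:R * (M + 1)).
have C0 : 0 <= C by rewrite !mulr_ge0// addr_ge0.
(* Dividing by [C + 1] instead of [C] covers the case [C = 0]. *)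
have e1 : 0 < Num.min r (e / (C + 1)).
  by rewrite lt_min r0 divr_gt0// ltr_wpDl.
have near_coord : \forall y \near x, `|Defs.coord c y - u| < Num.min r (e / (C + 1)).
  have cc := coord_cont chc cx.
  have /cvgrPdist_lt/(_ _ e1) := cc.
  by apply: filterS => y; rewrite distrC.
have near_dom : \forall y \near x, chart_dom c y.
  by apply: open_nbhs_nbhs; split => //; exact: chart_dom_open.
near=> y.
have cy : chart_dom c y by near: y.
have : `|Defs.coord c y - u| < Num.min r (e / (C + 1)) by near: y.
rewrite lt_min => /andP[br be].
set b := Defs.coord c y - u in br be.
have seg t : 0 <= t <= 1 -> `|u + t *: b - u| < r.
  move=> /andP[t0 t1]; rewrite addrC addKr normrZ ger0_norm//.
  by apply: le_lt_trans br; rewrite ler_piMl.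
have := @geodesic_dist_segment_le c u b M M0 Ac (fun t h => (rP _ (seg t h)).1)
  (fun t h => (rP _ (seg t h)).2).
rewrite [u + b]addrC subrK !(coordK chc)// => dle.
apply: le_lt_trans (lipF x y) _; apply: le_lt_trans (ler_wpM2l L0 dle) _.
rewrite mulrA -/C; apply: (@le_lt_trans _ _ ((C + 1) * `|b|)).
  by rewrite ler_wpM2r// lerDl.
by rewrite mulrC -ltr_pdivlMr// ltr_wpDl.
Unshelve. all: by end_near. Qed.

End Chart.
End Continuity.

(** * The orbits of the last structure group *)

Section LastGroup.
Context (R : realType).

Lemma cube_morphism_cst (m n : nat) (w : vertex n) :
  cube_morphism (fun _ : vertex m => w).
Proof.
exists 0, (\row_j (w j : nat)%:R) => v j.
by rewrite !mxE big1 ?add0r// => i _; rewrite mxE mulr0.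
Qed.

(** Any map on the 1-dimensional cube is a cube, and a constant morphism pulls it back to every
    dimension. *)
Lemma cst_cube (X : compactNilspace) n (x : X) : nil_cubes X n (fun=> x).
Proof.
have NX := nil_nilspace X.
exact: (nil_comp NX (nil_ergodic NX (fun=> x)) (cube_morphism_cst n (vertex1 1))).
Qed.

Lemma cube_morphism_reflect n :
  cube_morphism (fun v : vertex n => [ffun i => ~~ v i] : vertex n).
Proof.
exists (- 1%:M), (const_mx 1) => v j.
rewrite ffunE mxE (bigD1 j)//= big1 => [|i ij].
  by rewrite !mxE eqxx addr0; case: (v j).
by rewrite !mxE (negbTE ij) oppr0 mulr0.
Qed.

(** [sim] leaves the all-zero vertex free and [is_step] the all-one vertex; the reflection
    [v |-> 1 - v] exchanges the two corners. *)
Lemma sim_eq (X : compactNilspace) (k : nat) (x y : X) :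
  is_step (nil_cubes X) k -> sim (nil_cubes X) k x y -> x = y.
Proof.
move=> st [c [c' [Cc Cc' <- <- cc']]].
pose r := fun v : vertex k.+1 => [ffun i => ~~ v i] : vertex k.+1.
have NX := nil_nilspace X; have Mr := cube_morphism_reflect k.+1.
have r1 : r (vertex1 k.+1) = vertex0 k.+1 by apply/ffunP => i; rewrite !ffunE.
have rK v : r (r v) = v by apply/ffunP => i; rewrite !ffunE negbK.
have : c \o r = c' \o r.
  apply: st; [exact: nil_comp|exact: nil_comp|move=> v v1 /=].
  apply: cc'; apply: contra v1 => /eqP rv0.
  by rewrite -(rK v) rv0 -r1 rK.
by move=> /(congr1 (fun f => f (vertex1 _))) /=; rewrite -/r r1.
Qed.

(** Constant cubes show that [y] lies in its own class, hence in that of [x], and [sim_eq]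
    applies. *)
Lemma factor_map_inj (X : compactNilspace) (k : nat) :
  is_step (nil_cubes X) k -> injective (@factor_map X k).
Proof.
move=> st x y /(congr1 (fun u : nil_factor X k => proj1_sig u y)) /= h.
apply: (sim_eq st); rewrite h; exists (fun=> y), (fun=> y); split => //; exact: cst_cube.
Qed.

Lemma factor_map_surj (X : compactNilspace) (k : nat) (u : nil_factor X k) :
  exists x, factor_map k x = u.
Proof. by case: u => A [x Ax]; exists x; apply: eq_exist. Qed.

Context (Y : cfrNilspace R) (k : nat) (hk : (0 < k)%N)
  (st : is_step (nil_cubes Y) k).

(** [shift_last] is chosen by [get], which falls back on a default point when no element fits;
    surjectivity of [factor_map k] provides one that does. *)
Lemma factor_map_shift_last (x : Y) (z : Zgrp Y k) :
  factor_map k (shift_last x z) = sact (factor_map k x) z.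
Proof.
have [y yE] := factor_map_surj (sact (factor_map k x) z).
exact: (@getPex _ [set y | factor_map k y = sact (factor_map k x) z] (ex_intro _ y yE)).
Qed.

(** The action is continuous on the quotient. As [factor_map k] is injective, each open set of [Y]
    is the full preimage of its image, which is therefore open in the quotient, and continuity
    passes back to [Y]. *)
Lemma continuous_shift_last (x : Y) :
  continuous (fun z : Zgrp Y k => shift_last x z).
Proof.
apply/continuousP => U oU.
have oV : open (@factor_map Y k @` U).
  suff : open (@factor_map Y k @^-1` (@factor_map Y k @` U)) by [].
  rewrite (_ : _ @^-1` _ = U)//; apply/seteqP; split => [y [y' Uy' /(factor_map_inj st) <-]//|y Uy].
  by exists y.
have cz : continuous (fun z : Zgrp Y k => sact (factor_map k x) z).
  move=> z; apply: (@continuous_comp _ _ _ (fun z : Zgrp Y k => (factor_map k x, z))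
    (fun p => sact p.1 p.2)); last exact: sact_cont.
  exact: (@cvg_pair _ _ _ _ _ _ _ _ (nbhs_filter z) _ _ (cvg_cst _) cvg_id).
move/continuousP : cz => /(_ _ oV); congr open; apply/seteqP; split => z /=.
  by move=> [y Uy]; rewrite -factor_map_shift_last => /(factor_map_inj st) <-.
by move=> Uz; exists (shift_last x z) => //; rewrite factor_map_shift_last.
Qed.

Context (S : smoothStructure Y) (g : riemannianMetric S).

(** The additive map [p] stands for [complex.Re] or [complex.Im]. *)
Lemma continuous_lipschitz_part (p : {additive R[i] -> R}) (L : R) (F : Y -> R[i]) :
  (forall z, `|p z| <= cabs z) -> 0 <= L -> lipschitz_for g L F ->
  continuous (fun y => p (F y) : R^o).
Proof.
move=> pc L0 lF y; apply/cvgrPdist_lt => e e0.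
have := lipschitz_for_continuous L0 lF y e0; apply: filterS => y' /=.
by apply: le_lt_trans; rewrite -raddfB.
Qed.

Lemma bounded_measurable_shift (L b : R) (F : Y -> R[i]) (x : Y) :
  0 <= L -> lipschitz_for g L F -> norm_inf_le F b ->
  bounded_measurable ((fun z => F (shift_last x z)) : borel (pgroup (Zgrp Y k)) -> R[i]).
Proof.
move=> L0 lF Fb.
have c (p : {additive R[i] -> R}) : (forall z, `|p z| <= cabs z) ->
    continuous (fun z : Zgrp Y k => p (F (shift_last x z)) : R^o).
  move=> pc z; apply: (@continuous_comp _ _ _ (fun z : Zgrp Y k => shift_last x z)
    (fun y => p (F y) : R^o)); first exact: continuous_shift_last.
  exact: (continuous_lipschitz_part pc L0 lF).
split; last by exists b => z; exact: Fb.
- by apply: measurable_continuous; apply: (c (@complex.Re R)); exact: ler_Re_cabs.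
- by apply: measurable_continuous; apply: (c (@complex.Im R)); exact: ler_Im_cabs.
Qed.

(** At a fixed [x], the values [fourier_part F chi x] are by definition the Fourier coefficients of
    [z |-> F (x + z)] on the last structure group, so Bessel's inequality applies to this function
    bounded by [1]. *)
Lemma sum_sqr_fourier_part (L : R) (F : Y -> R[i]) (x : Y)
    (T : {fset (Zgrp Y k -> R[i])}) :
  0 <= L -> lipschitz_for g L F -> norm_inf_le F 1 ->
  (forall chi, chi \in T -> is_character chi) ->
  \sum_(chi <- T) cabs (fourier_part F chi x) ^+ 2 <= 1.
Proof.
move=> L0 lF F1 Tchar; have haar := @sg_haar _ _ (cfr_groups Y) k hk.
apply: (bessel_characters haar Tchar (h := fun z => F (shift_last x z))).
  exact: bounded_measurable_shift lF F1.
by move=> z; exact: F1.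
Qed.

End LastGroup.

(** * The energy estimate in the two ranges of [eta] *)

Theorem theorem5p9 (R : realType) (K : fixedChoices R) (k : nat) (hk : (0 < k)%N)
    (N : R -> (R -> nat -> R) -> nat) (hN : regularity_bound K k N)
    (D : R -> nat -> R) (hD : forall (e : R) (j : nat), 0 < e -> 0 < D e j)
    (eta : R) (heta : 0 < eta)
    (Z : finZmodType) (f : Z -> R[i]) (hf : norm_inf_le f 1)
    (m : nat) (hm : (1 <= m <= N eta D)%N)
    (dec : regularityDecomposition K k eta D f m) :
  `| lpnorm 2 f ^+ 2
     - \sum_(chi <- rd_S dec) lpnorm 2 (rd_g dec chi) ^+ 2
     - lpnorm 2 (rd_fr dec) ^+ 2 |
  <= (#|` rd_S dec|%:R ^+ 2 + 4) * D eta m + 8 * eta.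
Proof.
have D0 : 0 <= D eta m by rewrite ltW// hD.
have fs1 : norm_inf_le (rd_fs dec) 1 by move=> x; exact: rd_F_bounded.
suff main : `|energy f - \sum_(chi <- rd_S dec) energy (rd_g dec chi)
      - energy (rd_fr dec)| <= (#|` rd_S dec|%:R ^+ 2 + 4) * D eta m + 8 * eta.
  apply: le_trans main; rewrite le_eqVlt; apply/orP; left; apply/eqP.
  congr (`|_ - _ - _|); [exact: sqr_lpnorm2| |exact: sqr_lpnorm2].
  by apply: eq_bigr => chi _; exact: sqr_lpnorm2.
have [eta1|eta1] := lerP eta 1.
  (* Here [eta ^+ 2 <= eta], so this part of the error is at most [6 * eta]. *)
  have le8 : 5 * eta + eta ^+ 2 <= 8 * eta.
    have := ler_wpM2l (ltW heta) eta1; rewrite mulr1 -expr2; lra.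
  apply: le_trans _ (lerD (lexx _) le8).
  exact: (energy_decomposition (fset_uniq _) D0 (ltW heta) hf fs1
    (rd_fr_bounded dec) (rd_decomp dec) (rd_fs_decomp dec) (rd_fe_small dec)
    (rd_ge_small dec) (rd_fr_fs dec) (rd_fr_fe dec) (@rd_orth _ _ _ _ _ _ _ _ dec)).
(* Bessel's inequality at each point [rd_phi dec x], averaged over [Z]. *)
have sum_le1 : \sum_(chi <- rd_S dec) energy (rd_g dec chi) <= 1.
  rewrite /energy -avg_sum -[leRHS](avg_cst Z); apply: ler_avg => x.
  have h := sum_sqr_fourier_part hk (@rd_step _ _ _ _ _ _ _ _ dec) (rd_phi dec x)
    (ler0n _ m) (rd_F_lipschitz (r := dec)) (rd_F_bounded (r := dec))
    (@rd_S_char _ _ _ _ _ _ _ _ dec).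
  exact: h.
have sum_ge0 : 0 <= \sum_(chi <- rd_S dec) energy (rd_g dec chi).
  by apply: sumr_ge0 => chi _; exact: energy_ge0.
have fr_le1 := energy_le1 (rd_fr_bounded dec); have fr_ge0 := energy_ge0 (rd_fr dec).
have f_le1 := energy_le1 hf; have f_ge0 := energy_ge0 f.
have rhs_ge0 : 0 <= (#|` rd_S dec|%:R ^+ 2 + 4) * D eta m.
  by rewrite mulr_ge0// addr_ge0// sqr_ge0.
(* A number in [[0, 1]] minus two such numbers lies in [[-2, 1]], and [2 < 8 * eta]. *)
apply: (@le_trans _ _ 2); last by lra.
by apply/ler_normlP; split; lra.
Qed.
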